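(* For every integer $n\ge 1$, $\omega_n$ is the least ordinal $\varepsilon$ such that the inverse system $\mathbf d_n\mathbf P_n(\varepsilon)$ is not free.
   Context: For a set $A$ of ordinals and $n\ge 0$, $P_n(A)$ is the free abelian group with generators $\langle\vec\alpha\rangle$, $\vec\alpha\in[A]^{n+1}$ (strictly increasing $(n+1)$-tuples from $A$). For $n\ge1$, $d_n:P_n(A)\to P_{n-1}(A)$ is the homomorphism $\langle\vec\alpha\rangle\mapsto\sum_{i=0}^n(-1)^i\langle\vec\alpha^i\rangle$, where $\vec\alpha^i$ omits the $i$-th coordinate (counting from $0$). An inverse system of abelian groups indexed by an ordinal $\varepsilon$ is $\mathbf X=(X_\alpha,x_{\alpha\beta},\varepsilon)$ with groups $X_\alpha$ ($\alpha<\varepsilon$) and homomorphisms $x_{\alpha\beta}:X_\beta\to X_\alpha$ ($\alpha\le\beta<\varepsilon$) with $x_{\alpha\alpha}=\mathrm{id}$ and $x_{\alpha\gamma}=x_{\alpha\beta}x_{\beta\gamma}$. $\mathbf P_n(\varepsilon)$ is the system with terms $P_n([\alpha,\varepsilon))$ and the natural inclusions as bonding maps; for $n\ge1$, $\mathbf d_n\mathbf P_n(\varepsilon)$ is the system whose term at $\alpha$ is the subgroup $d_n(P_n([\alpha,\varepsilon)))$ of $P_{n-1}([\alpha,\varepsilon))$, with inclusions as bonding maps. A system $\mathbf X$ is free if there is a set $\mathcal B\subseteq\bigcup_{\alpha<\varepsilon}X_\alpha$ such that every $x$ in every $X_\alpha$ has a unique decomposition $x=\sum_{i<k}a_i\,x_{\alpha\beta_i}(b_i)$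 with $\alpha\le\beta_i$, $b_i\in X_{\beta_i}\cap\mathcal B$ distinct and $a_i$ nonzero integers. *)

(* Defs.v *)
From HB Require Import structures.
From mathcomp.multinomials Require Import freeg.
From mathcomp Require Import all_boot all_order all_algebra.
From mathcomp Require Import boolp classical_sets functions cardinality wochoice.

Set Implicit Arguments.
Unset Strict Implicit.
Unset Printing Implicit Defensive.

Import Order.TTheory GRing.Theory.
Local Open Scope ring_scope.

(* Ordinals are represented by well-ordered types, compared through their     *)
(* order types: ord_le e1 e2 says that e1 is isomorphic to an initial segment *)
(* of e2 (possibly all of it).                                                *)
Record ord := Ord {
  ord_disp : Order.disp_t;
  ord_sort :> orderType ord_disp;
  ordP : well_order (<=%O : rel ord_sort)
}.

Definition ord_le (e1 e2 : ord) : Prop :=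
  exists2 f : e1 -> e2,
    {mono f : x y / (x <= y)%O} &
    forall (x : e1) (y : e2), (y <= f x)%O -> exists z, f z = y.

Definition is_least_ord (P : ord -> Prop) (e : ord) : Prop :=
  P e /\ forall e', P e' -> ord_le e e'.

(* The order type of e is omega_n: omega_0 is the least infinite ordinal, and *)
(* omega_{n+1} the least ordinal of cardinality greater than that of omega_n. *)
Fixpoint is_omega (n : nat) (e : ord) : Prop :=
  if n is m.+1 then
    exists2 e0, is_omega m e0 &
      is_least_ord (fun e' : ord => ~ ([set: e'] #<= [set: e0])%card) e
  else is_least_ord (fun e' : ord => infinite_set [set: e']) e.

(* Ordinals are comparable, every nonempty class of ordinals has a least      *)
(* element, and hence omega_n exists.                                         *)
Section Existence.

Lemma ord_min (e : ord) (Q : e -> Prop) : (exists x, Q x) ->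
  exists x, Q x /\ forall y, Q y -> (x <= y)%O.
Proof.
move=> [x Qx]; have [|z [[/asboolP Qz lbz] _]] := @ordP e (fun x => `[< Q x >]).
  by exists x; apply/asboolP.
by exists z; split=> // y Qy; apply: lbz; apply/asboolP.
Qed.

Lemma ord_ind (e : ord) (Q : e -> Prop) :
  (forall x, (forall y, (y < x)%O -> Q y) -> Q x) -> forall x, Q x.
Proof.
move=> IH x; apply: contrapT => nQx.
have [z [nQz lbz]] := @ord_min e (fun x => ~ Q x) (ex_intro _ x nQx).
apply: nQz; apply: IH => y lt_yz; apply: contrapT => /lbz.
by rewrite leNgt lt_yz.
Qed.

Section Compare.
Variables V W : ord.

Let emb (f : V -> W) x :=
  (forall z z', (z <= x)%O -> (z' <= x)%O -> (f z <= f z')%O = (z <= z')%O) /\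
  (forall z w, (z <= x)%O -> (w <= f z)%O -> exists2 z', (z' <= x)%O & f z' = w).

Let emb_lt f x z z' : emb f x -> (z <= x)%O -> (z' <= x)%O ->
  (f z < f z')%O = (z < z')%O.
Proof. by move=> [fm _] hz hz'; rewrite !ltNge fm. Qed.

Let emb_uniq f g x x' : emb f x -> emb g x' ->
  forall z, (z <= x)%O -> (z <= x')%O -> f z = g z.
Proof.
move=> ef eg; apply: ord_ind => z IH zx zx'.
case: (ltgtP (f z) (g z)) => // lt.
- have [z' z'x' gz'] := eg.2 z (f z) zx' (ltW lt).
  have z'z : (z' < z)%O by rewrite -(emb_lt eg) // gz'.
  have /IH h := z'z; rewrite -h // in gz'; last exact: le_trans (ltW z'z) zx.
  by have := emb_lt ef (le_trans (ltW z'z) zx) zx; rewrite z'z gz' ltxx.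
- have [z' z'x fz'] := ef.2 z (g z) zx (ltW lt).
  have z'z : (z' < z)%O by rewrite -(emb_lt ef) // fz'.
  have /IH h := z'z; rewrite h // in fz'; last exact: le_trans (ltW z'z) zx'.
  by have := emb_lt eg (le_trans (ltW z'z) zx') zx'; rewrite z'z fz' ltxx.
Qed.

Let G x y := exists2 f, emb f x & f x = y.

Let G_fun x y y' : G x y -> G x y' -> y = y'.
Proof. by move=> [f ef <-] [g eg <-]; apply: (emb_uniq ef eg). Qed.

Let G_lt x y x' y' : G x y -> G x' y' -> (x < x')%O -> (y < y')%O.
Proof.
move=> [f ef <-] [g eg <-] xx'; rewrite (emb_uniq ef eg) ?(ltW xx') //.
by rewrite (emb_lt eg) ?(ltW xx').
Qed.

Let G_down x y w : G x y -> (w <= y)%O -> exists2 z, (z <= x)%O & G z w.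
Proof.
move=> [f ef <-] wy; have [z zx fz] := ef.2 x w (lexx x) wy; exists z => //.
exists f => //; split=> [u u' uz u'z|u v uz vu].
  by apply: ef.1; [exact: le_trans uz zx|exact: le_trans u'z zx].
have [t tx ft] := ef.2 u v (le_trans uz zx) vu; exists t => //.
by rewrite (le_trans _ uz) // -ef.1 ?ft // (le_trans uz zx).
Qed.

Lemma ord_comparable : ord_le V W \/
  exists (x : V) (g : W -> V), {mono g : u v / (u <= v)%O} /\
    forall z, (z < x)%O <-> exists w, g w = z.
Proof.
have [allG|/existsNP[x1 nG1]] := pselect (forall x, exists y, G x y).
  left; have [f fG] := choice allG; exists f.
    by apply: le_mono => x y; apply: G_lt.
  by move=> x y yx; have [z zx Gz] := G_down (fG x) yx; exists z; exact: G_fun Gz.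
right; have [x [nG minx]] := @ord_min V (fun x => ~ exists y, G x y)
  (ex_intro _ x1 nG1).
have Gx z : (z < x)%O -> exists y, G z y.
  by move=> zx; apply: contrapT => /minx; rewrite leNgt zx.
have surj w : exists2 z, (z < x)%O & G z w.
  apply: contrapT => nw.
  have [w0 [nw0 minw]] := @ord_min W (fun w => ~ exists2 z, (z < x)%O & G z w)
    (ex_intro _ w nw).
  have lt0 z y : (z < x)%O -> G z y -> (y < w0)%O.
    move=> zx Gzy; rewrite ltNge; apply/negP => w0y.
    have [u uz Gu] := G_down Gzy w0y.
    by apply: nw0; exists u => //; exact: le_lt_trans uz zx.
  have ex z : exists y, if (z < x)%O then G z y else y = w0.
    by have [zx|_] := boolP (z < x)%O; [exact: Gx|exists w0].
  have [f fP] := choice ex; apply: nG; exists w0.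
  have fx : f x = w0 by have := fP x; rewrite ltxx.
  have fG z : (z < x)%O -> G z (f z) by have := fP z; case: ifP.
  have flt z z' : (z <= x)%O -> (z' <= x)%O -> (z < z')%O -> (f z < f z')%O.
    move=> zx; rewrite le_eqVlt => /orP[/eqP->|z'x] zz'.
      by rewrite fx; apply: lt0 (fG _ zz').
    exact: (G_lt (fG _ (lt_trans zz' z'x)) (fG _ z'x) zz').
  exists f => //; split=> [z z' zx z'x|z u].
    case: (ltgtP z z') => [/(flt _ _ zx z'x)/ltW//|/(flt _ _ z'x zx)|->//].
      by rewrite leNgt => ->.
    by rewrite lexx.
  rewrite le_eqVlt => /orP[/eqP->|zx]; last first.
    move=> /(G_down (fG _ zx))[v vz Gv]; exists v.
      exact: le_trans vz (ltW zx).
    by apply: (G_fun _ Gv); apply: fG; exact: le_lt_trans zx.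
  rewrite fx le_eqVlt => /orP[/eqP->|uw0]; first by exists x.
  have [v vx Gv] : exists2 z, (z < x)%O & G z u.
    by apply: contrapT => /minw; rewrite leNgt uw0.
  by exists v; [exact: ltW|exact: G_fun (fG _ vx) Gv].
have /choice[g gP] : forall w, exists z, (z < x)%O /\ G z w.
  by move=> w; have [z zx Gz] := surj w; exists z.
exists x, g; split.
  apply: le_mono => u v uv; rewrite ltNge; apply/negP.
  rewrite le_eqVlt => /orP[/eqP vu|].
    have := (gP v).2; rewrite vu => /(G_fun (gP u).2) E.
    by rewrite E ltxx in uv.
  by move=> /(G_lt (gP v).2 (gP u).2); rewrite ltNge (ltW uv).
move=> z; split=> [zx|[w <-]]; last exact: (gP w).1.
have [y Gy] := Gx _ zx; exists y.
by have [/(G_lt (gP y).2 Gy)|/(G_lt Gy (gP y).2)|//] := ltgtP (g y) z;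
  rewrite ltxx.
Qed.

End Compare.

Lemma ord_le_trans e1 e2 e3 : ord_le e1 e2 -> ord_le e2 e3 -> ord_le e1 e3.
Proof.
move=> [f fm fi] [g gm gi]; exists (g \o f) => [x y|x y] /=.
  by rewrite gm fm.
move=> h; have [z gz] := gi _ _ h; rewrite -gz gm in h.
by have [t ft] := fi _ _ h; exists t; rewrite ft.
Qed.

Lemma least_ord_exists (P : ord -> Prop) :
  (exists e, P e) -> exists e, is_least_ord P e.
Proof.
move=> [V PV].
pose Q (x : V) := exists2 W, P W & exists g : W -> V,
  {mono g : u v / (u <= v)%O} /\ forall z, (z < x)%O <-> exists w, g w = z.
have [exQ|nQ] := pselect (exists x, Q x); last first.
  exists V; split=> // W PW; have [//|[x hx]] := ord_comparable V W.
  by exfalso; apply: nQ; exists x, W.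
have [x [[W PW [g [gm gi]]] minx]] := ord_min exQ.
exists W; split=> // W' PW'.
have [VW'|[x' [g' [g'm g'i]]]] := ord_comparable V W'.
  apply: ord_le_trans VW'; exists g => // w y yw; apply/gi.
  by apply: le_lt_trans yw _; apply/gi; exists w.
have xx' : (x <= x')%O by apply: minx; exists W' => //; exists g'.
have /choice[h hP] w : exists w', g' w' = g w.
  by apply/g'i; apply: lt_le_trans xx'; apply/gi; exists w.
exists h => [u v|u w hw]; first by rewrite -g'm !hP gm.
have : (g' w <= g u)%O by rewrite -hP g'm.
have gu : (g u < x)%O by apply/gi; exists u.
move=> /le_lt_trans /(_ gu) /gi [v gv]; exists v.
by apply: (inc_inj g'm); rewrite hP.
Qed.

Section OfRel.
Variables (T : choiceType) (R : rel T) (Rwo : well_order R).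

Definition wo_copy (_ : well_order R) : Type := T.
HB.instance Definition _ := Choice.on (wo_copy Rwo).

Let RC : wo_chain R predT. Proof. exact: withinW. Qed.
Let R_refl : reflexive R.
Proof. by move=> x; exact: (wo_chain_reflexive RC). Qed.
Let R_anti : antisymmetric R.
Proof. by move=> x y; exact: (wo_chain_antisymmetric RC). Qed.
Let R_total : total R.
Proof. by move=> x y; exact: (wo_chainW RC). Qed.
Let R_trans : transitive R.
Proof.
move=> y x z Rxy Ryz; have [|m [[mA lbm] _]] := Rwo (A := pred3 x y z).
  by exists x; rewrite !inE eqxx.
have [lx ly lz] : [/\ R m x, R m y & R m z].
  by split; apply: lbm; rewrite !inE eqxx ?orbT.
move: mA; rewrite !inE => /or3P[]/eqP E; rewrite E in lx ly lz => //.
  by have -> : x = y by apply: R_anti; rewrite Rxy lx.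
have <- : y = z by apply: R_anti; rewrite Ryz ly.
by [].
Qed.

HB.instance Definition _ :=
  Order.Le_isPOrder.Build (Order.Disp tt tt) (wo_copy Rwo) R_refl R_anti R_trans.
HB.instance Definition _ :=
  Order.POrder_isTotal.Build (Order.Disp tt tt) (wo_copy Rwo) R_total.

Definition ord_of_rel : ord := @Ord _ (wo_copy Rwo) Rwo.

End OfRel.

Lemma card_le_setTP (T U : Type) :
  ([set: T] #<= [set: U])%card <-> exists f : T -> U, injective f.
Proof.
split=> [/card_leP/unsquash f|[f f_inj]]; last first.
  by have := @card_ge_preimage T U setT f (in2W f_inj); rewrite preimage_setT.
pose i (x : T) : [set: T]%classic := SigSub (mem_set (I : [set: T]%classic x)).
exists (fun x => val (f (i x))) => x y /val_inj /inj.
by rewrite !inE => /(_ I I)/(congr1 val).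
Qed.

Lemma larger_ord_exists (T : Type) :
  exists e : ord, ~ ([set: e] #<= [set: T])%card.
Proof.
have [R Rwo] := well_ordering_principle (T -> Prop).
exists (ord_of_rel Rwo) => /card_le_setTP[g g_inj].
pose D y := exists2 A, g A = y & ~ A y.
have nD : ~ D (g D) by move=> Dg; have [A /g_inj -> ] := Dg.
by apply: (nD); exists D.
Qed.

Lemma is_omega_exists n : exists e, is_omega n e.
Proof.
elim: n => [|n [e0 e0P]]; last first.
  have [e eP] := least_ord_exists (larger_ord_exists e0).
  by exists e, e0.
apply: least_ord_exists.
have nat_wo : well_order (<=%O : rel nat).
  apply: antisymmetric_well_order => [|A Ane]; first exact: le_anti.
  by case: (ex_minnP (P := A) Ane) => m Am minm; exists m; split=> // k; apply: minm.
by exists (Ord nat_wo); exact: infinite_nat.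
Qed.

End Existence.

Record invsys (e : ord) := InvSys {
  term :> e -> zmodType;
  bond : forall a b : e, (a <= b)%O -> {additive term b -> term a};
  bond_id : forall (a : e) (le_aa : (a <= a)%O) (x : term a), bond le_aa x = x;
  bond_comp : forall (a b c : e) (le_ab : (a <= b)%O) (le_bc : (b <= c)%O)
      (le_ac : (a <= c)%O) (x : term c),
    bond le_ac x = bond le_ab (bond le_bc x)
}.

(* A decomposition of x : X a over B is a list of pairs (a_i, (beta_i, b_i))  *)
(* with beta_i in [a, e) and b_i in B at level beta_i; reduced says that the  *)
(* a_i are nonzero and the (beta_i, b_i) pairwise distinct.                   *)
Definition decomposition (e : ord) (X : invsys e) (B : forall b : e, set (X b))
    (a : e) (x : X a)
    (s : seq (int * {b : {b : e | (a <= b)%O} & X (val b)})) : Prop :=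
  [/\ reduced s,
      forall p, p \in s -> B (val (tag p.2)) (tagged p.2)
    & x = \sum_(p <- s) bond X (valP (tag p.2)) (tagged p.2) *~ p.1].

(* B is a subset of the disjoint union of the terms; uniqueness is up to the  *)
(* order of the summands.                                                     *)
Definition free_invsys (e : ord) (X : invsys e) : Prop :=
  exists B : forall b : e, set (X b), forall (a : e) (x : X a),
    exists2 s, decomposition B x s &
      forall s', decomposition B x s' -> perm_eq s s'.

Section Chains.
Variable e : ord.

Record incr (k : nat) := Incr {
  incr_tuple :> k.-tuple e;
  _ : sorted <%O incr_tuple
}.
HB.instance Definition _ k := [isSub for @incr_tuple k].
HB.instance Definition _ k := [Choice of incr k by <:].

Fact omit_subproof k (t : incr k.+1) (i : 'I_k.+1) :
  sorted <%O [tuple tnth t (lift i j) | j < k].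
Proof.
rewrite sorted_map; apply: (@sub_sorted _ (relpre val ltn)); last first.
  by rewrite -sorted_map val_enum_ord iota_ltn_sorted.
have [x0 _] : exists x0 : e, true by exists (tnth t i).
move=> j1 j2 /= lt_j; rewrite !(tnth_nth x0).
case: t => t /= st; rewrite lt_sorted_ltn_nth ?inE ?size_tuple //=;
  try exact: (ltn_ord (lift i _)).
rewrite /bump; case: (leqP i j1) => ij1.
  by rewrite (leq_trans ij1 (ltnW lt_j)) ltn_add2l.
by rewrite add0n (leq_trans lt_j) // leq_addl.
Qed.

Definition omit k (t : incr k.+1) (i : 'I_k.+1) : incr k :=
  Incr (omit_subproof t i).

(* chains k is free abelian on the increasing k-tuples of e, so that P_n(e)   *)
(* is chains n.+1 and, for n >= 1, bdry n is d_n : P_n(e) -> P_{n-1}(e).      *)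
Definition chains (k : nat) := {freeg (incr k)}.

Definition bdry (n : nat) : chains n.+1 -> chains n :=
  fglift (fun t : incr n.+1 => \sum_(i < n.+1) (-1) ^+ i *: << omit t i >>).

(* For a subset A of e, P_n(A) is the subgroup chains_in A of P_n(e): the     *)
(* elements all of whose generators have their entries in A.                  *)
Definition chains_in (k : nat) (A : {pred e}) : {pred chains k} :=
  [pred x | all (fun t : incr k => all (mem A) (incr_tuple t)) (dom x)].

(* The subgroup d_n(P_n([a, e))) of P_{n-1}(e).                               *)
Definition dP_pred (n : nat) (a : e) : {pred chains n} :=
  fun y => `[< exists2 x : chains n.+1,
      x \in chains_in [pred b : e | (a <= b)%O] & y = bdry x >].

Fact bdry_is_additive n : zmod_morphism (@bdry n).
Proof. exact: lift_is_additive. Qed.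
HB.instance Definition _ n :=
  GRing.isZmodMorphism.Build (chains n.+1) (chains n) (@bdry n)
    (@bdry_is_additive n).

Fact chains_in_zmod_closed k A : zmod_closed (@chains_in k A).
Proof.
split; first by rewrite inE dom0.
move=> x y /allP hx /allP hy; apply/allP => t /domB.
by rewrite mem_cat => /orP[/hx|/hy].
Qed.
HB.instance Definition _ k A :=
  GRing.isZmodClosed.Build (chains k) (@chains_in k A)
    (chains_in_zmod_closed k A).

Fact dP_zmod_closed n a : zmod_closed (@dP_pred n a).
Proof.
split; first by apply/asboolP; exists 0; rewrite ?rpred0 ?raddf0.
move=> _ _ /asboolP[x hx ->] /asboolP[y hy ->]; apply/asboolP.
by exists (x - y); rewrite ?rpredB ?raddfB.
Qed.
HB.instance Definition _ n a :=
  GRing.isZmodClosed.Build (chains n) (@dP_pred n a) (dP_zmod_closed n a).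

Record dP_term (n : nat) (a : e) := DPTerm {
  dP_val :> chains n;
  _ : dP_val \in dP_pred a
}.
HB.instance Definition _ n a := [isSub for @dP_val n a].
HB.instance Definition _ n a := [Choice of dP_term n a by <:].
HB.instance Definition _ n a :=
  [SubChoice_isSubZmodule of dP_term n a by <:].

Fact dP_bond_subproof n (a b : e) (le_ab : (a <= b)%O) (y : dP_term n b) :
  dP_val y \in dP_pred a.
Proof.
case: y => y /= /asboolP[x /allP hx ->]; apply/asboolP; exists x => //.
apply/allP => t /hx /allP h; apply/allP => z /h.
by rewrite !inE; exact: le_trans.
Qed.

Definition dP_bond n (a b : e) (le_ab : (a <= b)%O) (y : dP_term n b) :
  dP_term n a := DPTerm (dP_bond_subproof le_ab y).

Fact dP_bond_is_additive n (a b : e) (le_ab : (a <= b)%O) :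
  zmod_morphism (@dP_bond n a b le_ab).
Proof. by move=> x y; exact: val_inj. Qed.
HB.instance Definition _ n a b le_ab :=
  GRing.isZmodMorphism.Build (dP_term n b) (dP_term n a) (@dP_bond n a b le_ab)
    (@dP_bond_is_additive n a b le_ab).

Fact dP_bond_id n (a : e) (le_aa : (a <= a)%O) (y : dP_term n a) :
  dP_bond le_aa y = y.
Proof. exact: val_inj. Qed.

Fact dP_bond_comp n (a b c : e) (le_ab : (a <= b)%O) (le_bc : (b <= c)%O)
  (le_ac : (a <= c)%O) (y : dP_term n c) :
  dP_bond le_ac y = dP_bond le_ab (dP_bond le_bc y).
Proof. exact: val_inj. Qed.

Definition dP (n : nat) : invsys e :=
  @InvSys e (dP_term n) (fun a b le_ab => @dP_bond n a b le_ab)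
    (@dP_bond_id n) (@dP_bond_comp n).

End Chains.

(* Main.v *)
(* Let A be a set of size less than aleph_n in an ordinal. By induction on n  *)
(* there is a set S of n-simplices of A whose boundaries form a basis of the  *)
(* boundaries of n-simplices of A, simultaneously in every final segment of   *)
(* A: reorder A in type at most omega_(n-1), take such a set S_b of           *)
(* (n-1)-simplices for the predecessors of each b in the new order, and let S *)
(* consist of the s + {b} with s in S_b. Hence d_n P_n(e) is free for every   *)
(* ordinal e smaller than omega_n.                                            *)
(*   A basis of d_n P_n(e) yields a section of d_n respecting final segments. *)
(* Such a section cannot exist over a set D in which every subset of size     *)
(* less than aleph_n is strictly bounded. Indeed, choose D' in D closed under *)
(* the section, bounded by some g in D, and such that every subset of D' of   *)
(* size less than aleph_(n-1) is bounded in D'. Coning with g, applying the   *)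
(* section, and taking the coefficient of the complement of D', collapsed to  *)
(* a point, gives a section in dimension n-1 over D'. In dimension 0, a       *)
(* section would have a value whose support lies above every element of D.    *)
From HB Require Import structures.
From mathcomp.multinomials Require Import freeg.
From mathcomp Require Import all_boot all_order all_algebra.
From mathcomp Require Import boolp classical_sets functions cardinality.
From mathcomp Require Import wochoice.
Require Import Defs.

Set Implicit Arguments.
Unset Strict Implicit.
Unset Printing Implicit Defensive.

Import Order.TTheory GRing.Theory.
Local Open Scope classical_set_scope.
Local Open Scope ring_scope.

(** * Supports in free abelian groups *)

Section FreeGroups.
Variable K : choiceType.
Implicit Types (x : {freeg K}) (P Q : set K).

Lemma freegUZ k (t : K) : << k *g t >> = k *: << t >> :> {freeg K}.
Proof. by apply/eqP/freeg_eqP => u; rewrite coeffZ !coeffU mul1r. Qed.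

Lemma freegE x : x = \sum_(t <- dom x) coeff t x *: << t >>.
Proof. by rewrite -[LHS]freeg_sumE; apply: eq_bigr => t _; rewrite freegUZ. Qed.

Fact fglift_is_linear (M : lmodType int) (f : K -> M) : linear (fglift f).
Proof.
pose F := GRing.isZmodMorphism.Build _ _ (fglift f) (lift_is_additive f).
pose g : {additive {freeg K} -> M} := HB.pack (fglift f) F.
move=> a x y; rewrite -[fglift f]/(g : _ -> _) raddfD; congr (_ + _).
by rewrite -[a in LHS]intz -[a in RHS]intz !scaler_int raddfMz.
Qed.
HB.instance Definition _ (M : lmodType int) (f : K -> M) :=
  GRing.isLinear.Build int {freeg K} M _ (fglift f) (fglift_is_linear f).

Lemma fglift1 (M : lmodType int) (f : K -> M) t : fglift f << t >> = f t.
Proof. by rewrite liftU scale1r. Qed.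

Lemma freeg_neq0_dom x : x <> 0 -> exists t, t \in dom x.
Proof.
move/eqP; rewrite -dom_eq0; case: (dom x) => [//|t s] _.
by exists t; rewrite mem_head.
Qed.

Definition supported P : {pred {freeg K}} :=
  fun x => `[< {in dom x, forall t, P t} >].

Lemma supportedP P x : reflect {in dom x, forall t, P t} (x \in supported P).
Proof. exact: asboolP. Qed.

Fact supported_submod_closed P : submod_closed (supported P).
Proof.
split=> [|k x y /supportedP Px /supportedP Py].
  by apply/supportedP => t; rewrite dom0.
apply/supportedP => t /domD_subset.
by rewrite mem_cat => /orP[/domZ_subset/Px|/Py].
Qed.
HB.instance Definition _ P :=
  GRing.isSubmodClosed.Build int {freeg K} (supported P)
    (supported_submod_closed P).

Lemma supportedU P t : P t -> << t >> \in supported P.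
Proof. by move=> Pt; apply/supportedP => u; rewrite domU1 inE => /eqP->. Qed.

Lemma supported_sub P Q : P `<=` Q -> {subset supported P <= supported Q}.
Proof. by move=> PQ x /supportedP Px; apply/supportedP => t /Px/PQ. Qed.

Lemma supportedI P Q x :
  x \in supported P -> x \in supported Q -> x \in supported (P `&` Q).
Proof.
move=> /supportedP Px /supportedP Qx; apply/supportedP => t tx.
by split; [apply: Px|apply: Qx].
Qed.

Lemma supported_dom x : x \in supported [set` dom x].
Proof. exact/supportedP. Qed.

Lemma supported_set0 x : x \in supported set0 -> x = 0.
Proof. by move=> /supportedP x0; apply: contrapT => /freeg_neq0_dom[t /x0]. Qed.

Section Linear.
Variable M : lmodType int.
Implicit Types f g : {linear {freeg K} -> M}.

Lemma linear_supported (S : submodClosed M) P f x : x \in supported P ->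
  (forall t, P t -> f << t >> \in S) -> f x \in S.
Proof.
move=> /supportedP Px fS; rewrite [x]freegE linear_sum big_seq rpred_sum //.
by move=> t /Px/fS ft; rewrite linearZ rpredZ.
Qed.

Lemma eq_linear_supported P f g x : x \in supported P ->
  (forall t, P t -> f << t >> = g << t >>) -> f x = g x.
Proof.
move=> /supportedP Px fg; rewrite [x]freegE !linear_sum; apply: eq_big_seq => t.
by move=> /Px/fg fgt; rewrite !linearZ /= fgt.
Qed.

Lemma eq_linear f g : (forall t, f << t >> = g << t >>) -> f =1 g.
Proof. by move=> fg x; apply: (eq_linear_supported (supported_dom x)). Qed.

End Linear.

Lemma span_supported (S : submodClosed {freeg K}) P :
  (forall t, P t -> << t >> \in S) -> {subset supported P <= S}.
Proof. by move=> PS x Px; apply: (linear_supported (f := idfun) Px). Qed.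

End FreeGroups.

Definition freeg_map (K K' : choiceType) (f : K -> K') :
  {freeg K} -> {freeg K'} := fglift (fun t => << f t >>).
HB.instance Definition _ (K K' : choiceType) (f : K -> K') :=
  GRing.Linear.on (freeg_map f).

Lemma freeg_mapU (K K' : choiceType) (f : K -> K') t :
  freeg_map f << t >> = << f t >>.
Proof. exact: fglift1. Qed.

(** * Contraction and coning of simplicial chains *)

Section ContractCone.
Context {d} {T : orderType d}.
Implicit Types (a b g : T) (s t : seq T) (w v : T -> int).
Implicit Types (A B : set T) (k : nat).
Local Notation L := {freeg (seq T)}.
Implicit Types x y : L.

Definition increasing : set (seq T) := [set s | sorted <%O s].

Definition prepend a : L -> L := freeg_map (cons a).
HB.instance Definition _ a := GRing.Linear.on (prepend a).

(* On increasing lists, contract w is interior multiplication by w and cone g *)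
(* is exterior multiplication by g.                                           *)
Fixpoint contract_seq w s : L :=
  if s is a :: s' then w a *: << s' >> - prepend a (contract_seq w s') else 0.
Definition contract w : L -> L := fglift (contract_seq w).
HB.instance Definition _ w := GRing.Linear.on (contract w).

Fixpoint cone_seq g s : L :=
  if s is a :: s' then
    if (g < a)%O then << [:: g, a & s'] >>
    else if g == a then 0 else - prepend a (cone_seq g s')
  else << [:: g] >>.
Definition cone g : L -> L := fglift (cone_seq g).
HB.instance Definition _ g := GRing.Linear.on (cone g).

Definition boundary : L -> L := contract (fun=> 1).
HB.instance Definition _ := GRing.Linear.on boundary.

Lemma prependU a s : prepend a << s >> = << a :: s >>.
Proof. exact: freeg_mapU. Qed.

Lemma contractU w s : contract w << s >> = contract_seq w s.
Proof. exact: fglift1. Qed.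

Lemma coneU g s : cone g << s >> = cone_seq g s.
Proof. exact: fglift1. Qed.

Lemma boundary_point a : boundary << [:: a] >> = << [::] >>.
Proof. by rewrite [LHS]contractU /= linear0 subr0 scale1r. Qed.

Lemma contract_prepend w a x :
  contract w (prepend a x) = w a *: x - prepend a (contract w x).
Proof.
apply: (eq_linear (f := contract w \o prepend a)
  (g := (w a \*: idfun) \- (prepend a \o contract w))) => s /=.
by rewrite prependU !contractU.
Qed.

Lemma contractDl w v x :
  contract (fun a => w a + v a) x = contract w x + contract v x.
Proof.
apply: (eq_linear (f := contract _) (g := contract w \+ contract v)) => s /=.
rewrite !contractU; elim: s => [|a s IH] /=; first by rewrite addr0.
by rewrite IH scalerDl linearD opprD addrACA.
Qed.

Lemma contract_contract w x : contract w (contract w x) = 0.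
Proof.
apply: (eq_linear (f := contract w \o contract w) (g := \0)) => s /=.
rewrite contractU; elim: s => [|a s IH] /=; first by rewrite linear0.
by rewrite linearB linearZ /= contract_prepend contractU IH linear0 subr0 subrr.
Qed.

Lemma contract_anticomm w v x :
  contract w (contract v x) = - contract v (contract w x).
Proof.
have := contract_contract (fun a => w a + v a) x.
rewrite !contractDl !linearD /= !contract_contract add0r addr0 => /eqP.
by rewrite addr_eq0 => /eqP.
Qed.

Lemma cone_prepend g a x : cone g (prepend a x) =
  if (g < a)%O then prepend g (prepend a x)
  else if g == a then 0 else - prepend a (cone g x).
Proof.
case: ltgtP => ga.
- apply: (eq_linear (f := cone g \o prepend a) (g := prepend g \o prepend a)).
  by move=> s /=; rewrite !prependU coneU /= ga.
- apply: (eq_linear (f := cone g \o prepend a) (g := \- (prepend a \o cone g))).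
  by move=> s /=; rewrite prependU !coneU /= ltNge ltW //= gt_eqF.
- apply: (eq_linear (f := cone g \o prepend a) (g := \0)).
  by move=> s /=; rewrite prependU coneU /= ga ltxx eqxx.
Qed.

Lemma cone_seq_path g s : path <%O g s -> cone_seq g s = << g :: s >>.
Proof. by case: s => [//|a s] /= /andP[-> _]. Qed.

Lemma contract_cone w g x : x \in supported increasing ->
  contract w (cone g x) + cone g (contract w x) = w g *: x.
Proof.
move=> xs; apply: (eq_linear_supported xs
  (f := (contract w \o cone g) \+ (cone g \o contract w))
  (g := w g \*: idfun)) => {x xs} s /=; rewrite coneU contractU.
elim: s => [|a s IH] /= sa; first by rewrite contractU /= !linear0 !addr0.
rewrite linearB linearZ /= coneU cone_prepend; case: ltgtP => [ga|ag|ga].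
- have gs : path <%O g s by apply: path_le sa => //; exact: lt_trans.
  rewrite contractU /= cone_seq_path // linearB linearZ /= prependU.
  by rewrite subrK.
- rewrite linearN /= contract_prepend opprK opprB addrA subrK -linearD /=.
  by rewrite IH; [rewrite linearZ /= prependU|exact: path_sorted sa].
- by rewrite -ga in sa *; rewrite linear0 subr0 add0r cone_seq_path.
Qed.

Lemma boundary_cone g x : x \in supported increasing ->
  boundary (cone g x) = x - cone g (boundary x).
Proof.
move=> /(contract_cone (fun=> 1) g) homotopy.
by rewrite -[X in X - _]scale1r -homotopy addrK.
Qed.

Lemma contract_seq_face w s : contract_seq w s \in
  supported (fun t => subseq t s /\ (size t).+1 = size s).
Proof.
elim: s => [|a s IH] /=; first exact: rpred0.
rewrite rpredB ?rpredZ ?supportedU //; first by split=> //; exact: subseq_cons.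
apply: linear_supported IH _ => t [ts <-].
by rewrite /= prependU supportedU //=; rewrite eqxx.
Qed.

Lemma contract_seq_eq0 w s : {in s, w =1 fun=> 0} -> contract_seq w s = 0.
Proof.
elim: s => [//|a s IH] /= ws; rewrite (ws a) ?mem_head // scale0r IH.
  by rewrite linear0 subr0.
by move=> b bs; apply: ws; rewrite inE bs orbT.
Qed.

Lemma cone_seq_join g s : sorted <%O s -> cone_seq g s \in
  supported (fun t => sorted <%O t /\ perm_eq t (g :: s)).
Proof.
elim: s => [|a s IH] /= sa; first exact: supportedU.
case: ltgtP => [ga|ag|_]; last exact: rpred0.
  by rewrite supportedU //=; rewrite ga.
rewrite rpredN; apply: linear_supported (IH (path_sorted sa)) _ => t [st ts].
rewrite /= prependU supportedU //; split=> /=.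
  rewrite (path_sortedE lt_trans) st andbT (perm_all _ ts) /= ag.
  by have := sa; rewrite (path_sortedE lt_trans) => /andP[].
by rewrite -(perm_cons a) in ts; rewrite (permPl ts) (perm_catCA [:: a] [:: g]).
Qed.

Definition indicator b : T -> int := fun a => (a == b)%:R.

Lemma contract_indicator_seq b s : sorted <%O s ->
  contract_seq (indicator b) s \in
    supported (fun t => sorted <%O t /\ perm_eq s (b :: t)).
Proof.
elim: s => [|a s IH] /= sa; first exact: rpred0.
have ss := path_sorted sa; rewrite {1}/indicator.
have [a_b|ab] := eqVneq a b.
  subst b; rewrite contract_seq_eq0 ?linear0 ?addr0 ?scale1r ?supportedU //.
  move=> c cs; rewrite /indicator gt_eqF //.
  by move: sa; rewrite (path_sortedE lt_trans) => /andP[/allP/(_ c cs)].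
rewrite scale0r sub0r rpredN; apply: linear_supported (IH ss) _ => t [st ts].
rewrite /= prependU supportedU //; split=> /=.
  have := sa; rewrite !(path_sortedE lt_trans) st andbT (perm_all _ ts) /=.
  by move=> /andP[/andP[]].
by rewrite -(perm_cons a) in ts; rewrite (permPl ts) (perm_catCA [:: a] [:: b]).
Qed.

Lemma contract_indicator_avoid b x : x \in supported increasing ->
  contract (indicator b) x \in supported (fun t => b \notin t).
Proof.
move=> xs; apply: linear_supported xs _ => s ss.
rewrite /= contractU.
apply: supported_sub (contract_indicator_seq b ss) => t [st ts].
by move: (lt_sorted_uniq ss); rewrite (perm_uniq ts) => /andP[].
Qed.

Lemma cone_seq_mem g s : sorted <%O s -> g \in s -> cone_seq g s = 0.
Proof.
move=> ss gs; apply: supported_set0; apply: supported_sub (cone_seq_join g ss).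
by move=> t [/lt_sorted_uniq + ts]; rewrite (perm_uniq ts) /= gs.
Qed.

Lemma cone_contract_indicator b s : sorted <%O s -> b \in s ->
  cone b (contract (indicator b) << s >>) = << s >>.
Proof.
move=> ss bs.
have := contract_cone (indicator b) b (supportedU (P := increasing) ss).
by rewrite coneU cone_seq_mem // linear0 add0r /indicator eqxx scale1r.
Qed.

(* Here k counts vertices, so that the dimension is k - 1.                    *)
Definition simplex k A : set (seq T) :=
  [set s | [/\ sorted <%O s, size s = k & {in s, forall a, A a}]].

Lemma simplex_sub k A B : A `<=` B -> simplex k A `<=` simplex k B.
Proof. by move=> AB s [ss sk sA]; split=> // a /sA/AB. Qed.

Lemma simplex_perm_cons k A b s t : sorted <%O t -> perm_eq t (b :: s) ->
  A b -> simplex k A s -> simplex k.+1 A t.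
Proof.
move=> st ts Ab [_ sk sA]; split=> // [|a].
  by rewrite (perm_size ts) /= sk.
by rewrite (perm_mem ts) inE => /predU1P[->|/sA].
Qed.

Lemma simplex_head_le k A b s : simplex k A (b :: s) -> all (>= b)%O (b :: s).
Proof.
move=> [+ _ _]; rewrite /= lexx /= (path_sortedE lt_trans) => /andP[bs _].
by apply: sub_all bs => c /ltW.
Qed.

Lemma simplex_increasing k A x : x \in supported (simplex k A) ->
  x \in supported increasing.
Proof. by apply: supported_sub => s []. Qed.

Lemma contract_simplex w k A x : x \in supported (simplex k.+1 A) ->
  contract w x \in supported (simplex k A).
Proof.
move=> xA; apply: linear_supported xA _ => s [ss sk sA].
rewrite /= contractU.
apply: supported_sub (contract_seq_face w s) => t [ts st]; split.
- exact: subseq_sorted lt_trans _ _ ts ss.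
- by move: st; rewrite sk => -[].
- by move=> a /(mem_subseq ts)/sA.
Qed.

Lemma cone_simplex g k A x : A g -> x \in supported (simplex k A) ->
  cone g x \in supported (simplex k.+1 A).
Proof.
move=> Ag xA; apply: linear_supported xA _ => s sA.
rewrite /= coneU; have [ss _ _] := sA.
apply: supported_sub (cone_seq_join g ss) => t [st ts].
exact: (simplex_perm_cons st ts Ag sA).
Qed.

Lemma cycle_is_boundary k A x :
  x \in supported (simplex k.+1 A) -> boundary x = 0 ->
  exists2 y, y \in supported (simplex k.+2 A) & boundary y = x.
Proof.
move=> xA x0; have [->|/freeg_neq0_dom[s sx]] := pselect (x = 0).
  by exists 0; rewrite ?rpred0 ?linear0.
case: (supportedP _ _ xA s sx) => ss; case: s ss sx => [//|b s] _ _ _ sA.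
exists (cone b x); first by apply: cone_simplex xA; apply: sA; exact: mem_head.
by rewrite boundary_cone ?x0 ?linear0 ?addr0 //; exact: (simplex_increasing xA).
Qed.

End ContractCone.

(** * Bases of boundaries *)

Lemma exists_argmax (T : eqType) d (W : orderType d) (f : T -> W)
    (s : seq T) x :
  x \in s -> exists2 m, m \in s & {in s, forall y, (f y <= f m)%O}.
Proof.
elim: s x => [//|a [|b s] IH] _ _.
  by exists a; rewrite ?mem_head // => y; rewrite inE => /eqP->.
have [m ms maxm] := IH b (mem_head _ _).
have [am|/ltW ma] := leP (f a) (f m).
  by exists m => [|y]; rewrite in_cons ?ms ?orbT // => /predU1P[->|/maxm].
exists a; rewrite ?mem_head // => y; rewrite inE => /predU1P[->//|/maxm ym].
exact: le_trans ym ma.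
Qed.

Section BoundaryBases.
Context {d} {T : orderType d}.
Implicit Types (a b c : T) (s t : seq T) (A : set T) (S : set (seq T)).
Implicit Type k : nat.
Implicit Types x y z : {freeg (seq T)}.

Definition tail A a : set T := [set b | A b /\ (a <= b)%O].

Definition above S a : set (seq T) := [set s | S s /\ all (>= a)%O s].

Lemma tail_sub A a : tail A a `<=` A.
Proof. by move=> b []. Qed.

Lemma simplex_tail k A a s : simplex k (tail A a) s <-> above (simplex k A) a s.
Proof.
split=> [[ss sk sA]|[[ss sk sA] /allP as_]].
  by split; [split=> // b /sA[]|apply/allP => b /sA[]].
by split=> // b bs; split; [apply: sA|apply: as_].
Qed.

Definition boundary_span S : {pred {freeg (seq T)}} :=
  fun x => `[< exists2 z, z \in supported S & boundary z = boundary x >].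

Fact boundary_span_submod_closed S : submod_closed (boundary_span S).
Proof.
split=> [|k x y /asboolP[z Sz zx] /asboolP[z' Sz' zy]]; apply/asboolP.
  by exists 0; first exact: rpred0.
by exists (k *: z + z'); rewrite ?rpredD ?rpredZ // !linearP /= zx zy.
Qed.
HB.instance Definition _ S :=
  GRing.isSubmodClosed.Build int {freeg (seq T)} (boundary_span S)
    (boundary_span_submod_closed S).

(* In other words, the boundaries of S form a basis of the boundaries of the  *)
(* simplices of A, and this remains true in every final segment.              *)
Definition boundary_basis k A S : Prop :=
  [/\ S `<=` simplex k A,
      forall x, x \in supported S -> boundary x = 0 -> x = 0
    & forall a s, simplex k (tail A a) s ->
        << s >> \in boundary_span (above S a)].

Lemma boundary_basis_span k A S a : boundary_basis k A S ->
  {subset supported (simplex k (tail A a)) <= boundary_span (above S a)}.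
Proof. by move=> [_ _ spanS]; apply: span_supported => s; apply: spanS. Qed.

Lemma finite_boundary_basis A : finite_set A -> exists S, boundary_basis 1 A S.
Proof.
move=> /finite_seqP[u uA].
have [[a0 Aa0]|A0] := pselect (A !=set0); last first.
  exists set0; split=> [//|x /supported_set0 -> //|a [|b s] [_ // _ sA]].
  by case: A0; exists b; have [] := sA b (mem_head _ _).
have [m um maxm] : exists2 m, m \in u & {in u, forall b, (b <= m)%O}.
  by apply: (@exists_argmax _ _ _ id u a0); move: Aa0; rewrite uA.
exists [set [:: m]]; split=> [_ ->|x xm x0|a [|b [|b' s]] [_ // _ sA]].
- by split=> // a; rewrite inE => /eqP->; rewrite uA.
- rewrite -[x](eq_linear_supported xm (f := cone m \o boundary) (g := idfun)).
    by rewrite /= x0 linear0.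
  by move=> _ -> /=; rewrite boundary_point coneU.
have [Ab ab] := sA b (mem_head _ _).
apply/asboolP; exists << [:: m] >>; last by rewrite !boundary_point.
apply: supportedU; split; rewrite //= andbT (le_trans ab) // maxm //.
by move: Ab; rewrite uA.
Qed.

Section Join.
Variables (A : set T) (W : ord) (f : T -> W) (k : nat) (B : T -> set (seq T)).
Hypothesis f_inj : {in A &, injective f}.

Definition predecessors b : set T := [set c | A c /\ (f c < f b)%O].

Hypothesis basisB : forall b, A b -> boundary_basis k.+1 (predecessors b) (B b).

Definition joins : set (seq T) := [set t | increasing t /\
  exists b s, [/\ A b, B b s & perm_eq t (b :: s)]].

Lemma joins_simplex : joins `<=` simplex k.+2 A.
Proof.
move=> t [st [b [s [Ab Bs ts]]]]; have [/(_ _ Bs) sb _ _] := basisB Ab.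
by apply: (simplex_perm_cons st ts Ab); apply: simplex_sub sb => c [].
Qed.

Lemma contract_indicator_joins b t : A b -> joins t ->
  {in t, forall c, (f c <= f b)%O} ->
  contract (indicator b) << t >> \in supported (B b).
Proof.
move=> Ab [st [b' [s' [Ab' Bs' ts']]]] maxb; rewrite contractU.
apply: supported_sub (contract_indicator_seq b st) => s [ss ts].
have [/(_ _ Bs') [ss' _ s'b'] _ _] := basisB Ab'.
have b_b' : b = b'.
  have : b \in b' :: s' by rewrite -(perm_mem ts') (perm_mem ts) mem_head.
  rewrite inE => /predU1P[//|/s'b'[_]].
  by rewrite ltNge maxb // (perm_mem ts') mem_head.
subst b'; have ss's : perm_eq s s'.
  by rewrite -(perm_cons b) -(permPl ts).
by rewrite (lt_sorted_eq ss ss' (perm_mem ss's)).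
Qed.

Lemma joins_free x : x \in supported joins -> boundary x = 0 -> x = 0.
Proof.
move=> xJ x0; apply: contrapT => /freeg_neq0_dom[t0 t0x].
have xinc : x \in supported increasing by apply: supported_sub xJ => t [].
have [_ [b0 [s0 [_ _ t0s0]]]] := supportedP _ _ xJ _ t0x.
have [|b bx maxb] := @exists_argmax _ _ _ f (flatten (dom x)) b0.
  by apply/flattenP; exists t0; rewrite // (perm_mem t0s0) mem_head.
have [t tx bt] := flattenP bx.
have Ab : A b by have [_ _] := joins_simplex (supportedP _ _ xJ _ tx); apply.
have [_ freeB _] := basisB Ab.
have xb0 : contract (indicator b) x = 0.
  apply: freeB; last first.
    by rewrite /boundary contract_anticomm -/(boundary x) x0 linear0 oppr0.
  apply: linear_supported (supported_dom x) _ => {tx bt}t /= tx.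
  apply: contract_indicator_joins => //; first exact: (supportedP _ _ xJ).
  by move=> c ct; apply: maxb; apply/flattenP; exists t.
have xE := contract_cone (indicator b) b xinc.
rewrite xb0 linear0 addr0 /indicator eqxx scale1r in xE.
have : x \in supported (fun s => b \notin s).
  rewrite -xE contract_indicator_avoid //; apply: simplex_increasing.
  exact: cone_simplex Ab (supported_sub joins_simplex xJ).
by move=> /supportedP/(_ t tx); rewrite bt.
Qed.

(* x has the same boundary as a chain z on B b; then cone b z is a chain on   *)
(* joins, and the cycle x - z bounds among the predecessors of b.             *)
Lemma cone_joins_span a b x : A b -> (a <= b)%O ->
  x \in supported (simplex k.+1 (tail (predecessors b) a)) ->
  exists2 y, y \in supported (simplex k.+2 (tail (predecessors b) a))
    & cone b x - y \in boundary_span (above joins a).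
Proof.
move=> Ab ab xI; have [subB _ _] := basisB Ab.
have /asboolP[z zB zx] := boundary_basis_span (basisB Ab) xI.
have zI : z \in supported (simplex k.+1 (tail (predecessors b) a)).
  apply: supported_sub zB => s [/subB sI sa]; exact/simplex_tail.
have [|y yI yE] := @cycle_is_boundary _ _ _ _ (x - z) (rpredB xI zI).
  by rewrite linearB /= zx subrr.
exists y => //; apply/asboolP; exists (cone b z).
  apply: linear_supported zB _ => s [Bs sa]; have [ss _ _] := subB _ Bs.
  rewrite /= coneU; apply: supported_sub (cone_seq_join b ss) => t [st ts].
  split; first by split=> //; exists b, s.
  by rewrite (perm_all _ ts) /= ab.
rewrite linearB /= yE !boundary_cone ?zx; last first.
- exact: simplex_increasing zI.
- exact: simplex_increasing xI.
by rewrite opprB addrCA addrAC subrr add0r.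
Qed.

Lemma simplex_joins_span a t : simplex k.+2 (tail A a) t ->
  exists2 b, b \in t &
  exists2 y, y \in supported (simplex k.+2 (tail (predecessors b) a))
    & << t >> - y \in boundary_span (above joins a).
Proof.
move=> tA; have [st tk tA'] := tA.
have [b bt maxb] : exists2 b, b \in t & {in t, forall c, (f c <= f b)%O}.
  by case: t tk {tA st tA'} => // b0 t _; exact: exists_argmax (mem_head b0 t).
have [Ab ab] := tA' b bt; exists b => //.
rewrite -(cone_contract_indicator st bt).
apply: cone_joins_span => //; rewrite contractU.
apply: supported_sub (contract_indicator_seq b st) => s [ss ts]; split=> //.
  by move: (perm_size ts); rewrite tk => -[].
move=> c cs; have ct : c \in t by rewrite (perm_mem ts) inE cs orbT.
have [Ac ac] := tA' c ct; split=> //; split=> //.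
rewrite lt_neqAle maxb // andbT; apply/eqP => /f_inj.
rewrite !in_setE => /(_ Ac Ab) c_b; move: (lt_sorted_uniq st).
by rewrite (perm_uniq ts) /= -c_b cs.
Qed.

Lemma predecessors_joins_span a b :
  {subset supported (simplex k.+2 (tail (predecessors b) a))
    <= boundary_span (above joins a)}.
Proof.
have [w fb] : exists w, f b = w by exists (f b).
elim/ord_ind: w b fb => w IH b fb; apply: span_supported => t tb.
have tA : simplex k.+2 (tail A a) t.
  by apply: simplex_sub tb => c [[]].
have [b' b't [y yb' yt]] := simplex_joins_span tA.
rewrite -[<< t >>](subrK y) rpredD // (IH (f b') _ b') // -fb.
by have [_ _ /(_ b' b't)[[]]] := tb.
Qed.

Lemma boundary_basis_joins : boundary_basis k.+2 A joins.
Proof.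
split=> [||a t tA]; [exact: joins_simplex|exact: joins_free|].
have [b _ [y yb yt]] := simplex_joins_span tA.
by rewrite -[<< t >>](subrK y) rpredD // (predecessors_joins_span yb).
Qed.

End Join.

Lemma boundary_basisS A (W : ord) (f : T -> W) k : {in A &, injective f} ->
  (forall b, A b -> exists S, boundary_basis k.+1 (predecessors A f b) S) ->
  exists S, boundary_basis k.+2 A S.
Proof.
move=> f_inj basisA; have /choice[B basisB] b : exists S,
    A b -> boundary_basis k.+1 (predecessors A f b) S.
  by have [/basisA[S SP]|nAb] := pselect (A b); [exists S|exists set0].
by exists (joins A B); apply: boundary_basis_joins basisB.
Qed.

End BoundaryBases.

(** * Splittings of the boundary map *)

Section Splittings.
Context {d} {T : orderType d}.
Implicit Types (a b g : T) (s t : seq T) (D : set T) (k : nat).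
Local Notation L := {freeg (seq T)}.
Implicit Types (x y : L) (f : {linear L -> L}).

(* f is s o boundary for a section s of the boundary map on the simplices of  *)
(* D that respects all final segments: the second clause says that s is a     *)
(* section, the last one that s is well defined.                              *)
Definition boundary_splitting k D f : Prop :=
  [/\ forall a x, x \in supported (simplex k (tail D a)) ->
        f x \in supported (simplex k (tail D a)),
      forall x, x \in supported (simplex k D) -> boundary (f x) = boundary x
    & forall x, x \in supported (simplex k D) -> boundary x = 0 -> f x = 0].

Lemma boundary_splitting_simplex k D f x : boundary_splitting k.+1 D f ->
  x \in supported (simplex k.+1 D) -> f x \in supported (simplex k.+1 D).
Proof.
move=> [f_tail _ _] xD; apply: linear_supported xD _ => -[[_ //]|a s] sD.
apply: supported_sub (simplex_sub (@tail_sub _ _ D a)) _ (f_tail a _ _).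
by apply: supportedU; apply/simplex_tail; split=> //; exact: simplex_head_le sD.
Qed.

Lemma no_boundary_splitting1 D f : D !=set0 ->
  (forall b, D b -> exists2 c, D c & (b < c)%O) -> ~ boundary_splitting 1 D f.
Proof.
move=> [b0 Db0] Dlim [f_tail f_bd f_cycle].
have point a b : D b -> (a <= b)%O ->
    << [:: b] >> \in supported (simplex 1 (tail D a)).
  by move=> Db ab; apply: supportedU; split=> // c; rewrite inE => /eqP->.
have pointD b : D b -> << [:: b] >> \in supported (simplex 1 D).
  move=> Db; apply: supported_sub (point b b Db (lexx b)).
  exact: simplex_sub (@tail_sub _ _ D b).
have f_eq b : D b -> f << [:: b] >> = f << [:: b0] >>.
  move=> Db; apply/eqP; rewrite -subr_eq0 -linearB f_cycle ?rpredB ?pointD //.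
  by rewrite linearB /= !boundary_point subrr.
have [t tf] : exists t, t \in dom (f << [:: b0] >>).
  apply: freeg_neq0_dom => f0; have := f_bd _ (pointD _ Db0).
  by rewrite f0 linear0 boundary_point => /esym/eqP; rewrite freegU_eq0.
have tP c : D c -> simplex 1 (tail D c) t.
  move=> Dc; have fc := f_tail c _ (point c c Dc (lexx c)).
  by apply: (supportedP _ _ fc); rewrite f_eq.
case: t {tf} tP => [/(_ _ Db0)[_ //]|b t] tP.
have [_ _ /(_ b (mem_head _ _))[/Dlim[c Dc bc] _]] := tP _ Db0.
by have [_ _ /(_ b (mem_head _ _))[_]] := tP _ Dc; rewrite leNgt bc.
Qed.

Section Collapse.
Variable p : pred T.

Definition restrict : L -> L :=
  fglift (fun s => if all p s then << s >> else 0).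
HB.instance Definition _ := GRing.Linear.on restrict.

Let inside a : int := (p a)%:R.
Let outside a : int := (~~ p a)%:R.

(* The chain map induced by collapsing the complement of p to one point lying *)
(* beyond p, followed by the coefficient of that point.                       *)
Definition collapse : L -> L := restrict \o contract outside.
HB.instance Definition _ :=
  GRing.Linear.copy collapse (restrict \o contract outside).

Lemma restrict_id x : x \in supported (all p) -> restrict x = x.
Proof.
move=> xp; apply: (eq_linear_supported xp (f := restrict) (g := idfun)) => s sp.
by rewrite [LHS]fglift1 sp.
Qed.

Lemma restrict_simplex k D x : x \in supported (simplex k D) ->
  restrict x \in supported (simplex k [set a | D a /\ p a]).
Proof.
move=> xD; apply: linear_supported xD _ => s [ss sk sD].
rewrite /= [restrict _]fglift1; case: allP => sp; last exact: rpred0.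
by apply: supportedU; split=> // a as_; split; [apply: sD|apply: sp].
Qed.

Lemma restrict_prepend a x :
  restrict (prepend a x) = if p a then prepend a (restrict x) else 0.
Proof.
have restrU s : restrict << s >> = if all p s then << s >> else 0.
  exact: fglift1.
have [pa|npa] := boolP (p a).
  apply: (eq_linear (f := restrict \o prepend a) (g := prepend a \o restrict)).
  move=> s /=; rewrite prependU !restrU /= pa /=.
  by case: ifP; rewrite ?prependU ?linear0.
apply: (eq_linear (f := restrict \o prepend a) (g := \0)) => s /=.
by rewrite prependU restrU /= (negPf npa).
Qed.

Lemma restrict_contract_inside x :
  restrict (contract inside x) = boundary (restrict x).
Proof.
apply: (eq_linear (f := restrict \o contract inside)
  (g := boundary \o restrict)) => s /=.
rewrite contractU; elim: s => [|a s IH] /=.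
  by rewrite linear0 [restrict _]fglift1 [RHS]contractU.
rewrite linearB linearZ /= restrict_prepend IH -prependU restrict_prepend.
rewrite /inside; case: (p a); last by rewrite scale0r subrr linear0.
by rewrite /boundary contract_prepend.
Qed.

Lemma boundaryE x : boundary x = contract inside x + contract outside x.
Proof.
rewrite -contractDl /boundary; congr contract; apply/funext => a.
by rewrite /inside /outside; case: (p a).
Qed.

Lemma boundary_collapse x : boundary (collapse x) = - collapse (boundary x).
Proof.
rewrite /collapse /= -restrict_contract_inside contract_anticomm linearN /=.
by rewrite boundaryE linearD /= contract_contract addr0.
Qed.

Lemma contract_outside_eq0 x :
  x \in supported (all p) -> contract outside x = 0.
Proof.
move=> xp; apply: (eq_linear_supported xp (f := contract outside) (g := \0)).
move=> s /allP sp; rewrite /= contractU contract_seq_eq0 // => a /sp.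
by rewrite /outside => ->.
Qed.

Lemma collapse_eq0 x : x \in supported (all p) -> collapse x = 0.
Proof. by move=> xp; rewrite /collapse /= contract_outside_eq0 // linear0. Qed.

Lemma collapse_cone g x : ~~ p g -> x \in supported increasing ->
  x \in supported (all p) -> collapse (cone g x) = x.
Proof.
move=> pg xinc xp; have := contract_cone outside g xinc.
rewrite (contract_outside_eq0 xp) linear0 addr0 /outside pg scale1r.
by rewrite /collapse /= => ->; exact: restrict_id.
Qed.

Lemma collapse_simplex k D x : x \in supported (simplex k.+1 D) ->
  collapse x \in supported (simplex k [set a | D a /\ p a]).
Proof. by move=> xD; apply: restrict_simplex; apply: contract_simplex. Qed.

End Collapse.

Section Descent.
Variables (k : nat) (D D' : set T) (g : T) (f : {linear L -> L}).
Hypotheses (f_split : boundary_splitting k.+2 D f) (D'D : D' `<=` D) (Dg : D g).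
Hypothesis D'g : forall b, D' b -> (b < g)%O.
Hypothesis f_D' : forall x,
  x \in supported (simplex k.+2 D') -> f x \in supported (simplex k.+2 D').

Let p : pred T := fun a => `[< D' a >].

Let simplex_p j x : x \in supported (simplex j D') -> x \in supported (all p).
Proof.
by apply: supported_sub => s [_ _ sD']; apply/allP => a /sD' D'a; exact/asboolP.
Qed.

Let cone_D x :
  x \in supported (simplex k.+1 D') -> cone g x \in supported (simplex k.+2 D).
Proof.
move=> xD'; apply: cone_simplex Dg _; apply: supported_sub xD'.
exact: simplex_sub.
Qed.

Definition descent : L -> L := collapse p \o f \o cone g.
HB.instance Definition _ :=
  GRing.Linear.copy descent (collapse p \o f \o cone g).

Lemma descent_tail a x : x \in supported (simplex k.+1 (tail D' a)) ->
  descent x \in supported (simplex k.+1 (tail D' a)).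
Proof.
move=> xa; apply: linear_supported xa _ => -[[_ //]|b s] sa.
have [f_tail _ _] := f_split; have [_ _ /(_ b (mem_head _ _))[D'b ab]] := sa.
have ga : tail D a g by split=> //; exact: le_trans ab (ltW (D'g D'b)).
have sDa : << b :: s >> \in supported (simplex k.+1 (tail D a)).
  apply: supportedU; apply: simplex_sub sa => c [D'c ac].
  by split=> //; exact: D'D.
have := collapse_simplex p (f_tail a _ (cone_simplex ga sDa)).
by apply: supported_sub; apply: simplex_sub => c [[_ ac] /asboolP].
Qed.

Lemma boundary_descent x : x \in supported (simplex k.+1 D') ->
  boundary (descent x) = boundary x.
Proof.
move=> xD'; have [_ f_bd _] := f_split; have xinc := simplex_increasing xD'.
rewrite /descent /= boundary_collapse f_bd ?cone_D // boundary_cone //.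
rewrite linearB /= (collapse_eq0 (simplex_p xD')) sub0r opprK.
rewrite collapse_cone //.
- by apply/asboolP => /D'g; rewrite ltxx.
- exact: simplex_increasing (contract_simplex _ xD').
- exact: simplex_p (contract_simplex _ xD').
Qed.

(* A cycle x of D' bounds some y over D'; as f kills the cycle cone g x - y,  *)
(* the chain f (cone g x) = f y lies over D', where collapse vanishes.        *)
Lemma descent_cycle x : x \in supported (simplex k.+1 D') -> boundary x = 0 ->
  descent x = 0.
Proof.
move=> xD' x0; have [_ _ f_cycle] := f_split.
have [y yD' yx] := cycle_is_boundary xD' x0.
have yD : y \in supported (simplex k.+2 D).
  by apply: supported_sub yD'; exact: simplex_sub.
rewrite /descent /= (_ : f (cone g x) = f y).
  by rewrite collapse_eq0 // (simplex_p (f_D' yD')).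
apply/eqP; rewrite -subr_eq0 -linearB f_cycle ?rpredB ?cone_D //.
rewrite linearB /= boundary_cone ?x0 ?linear0 ?addr0 ?yx ?subrr //.
exact: simplex_increasing xD'.
Qed.

Lemma descent_splitting : boundary_splitting k.+1 D' descent.
Proof.
by split; [exact: descent_tail|exact: boundary_descent|exact: descent_cycle].
Qed.

End Descent.

End Splittings.

(** * Infinite cardinals *)

Lemma well_order_relpre (T U : choiceType) (f : T -> U) (R : rel U) :
  injective f -> well_order R -> well_order (relpre f R).
Proof.
move=> f_inj Rwo; apply: antisymmetric_well_order => [x y Rxy|A [x Ax]].
  have RC : wo_chain R predT by exact: withinW.
  by apply: f_inj; apply: (wo_chain_antisymmetric RC).
have [|_ [[/asboolP[z Az <-] minz] _]] :=
    Rwo (fun u => `[< exists2 z, z \in A & f z = u >]).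
  by exists (f x); apply/asboolP; exists x.
by exists z; split=> // y Ay; apply: minz; apply/asboolP; exists y.
Qed.

Lemma lexi_well_order (V W : ord) : well_order (<=%O : rel (V *l W)).
Proof.
apply: antisymmetric_well_order => [|A [[v w] Avw]]; first exact: le_anti.
have [|a [[b Aab] mina]] := @ord_min V (fun a => exists b, (a, b) \in A).
  by exists v, w.
have [|c [Aac minc]] := @ord_min W (fun c => (a, c) \in A); first by exists b.
exists (a, c); split=> // -[a' c'] A'.
have aa' : (a <= a')%O by apply: mina; exists c'.
rewrite leEprodlexi /= aa'; apply/implyP => a'a; apply: minc.
by rewrite (@le_anti _ _ a a') // aa'.
Qed.

Definition ord_lexi (V W : ord) : ord := Ord (@lexi_well_order V W).

Lemma ord_lexi_fst_le (V W : ord) (x y : ord_lexi V W) :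
  (x <= y)%O -> (x.1 <= y.1)%O.
Proof. by rewrite leEprodlexi => /andP[]. Qed.

Definition segment (W : ord) (y : W) : ord :=
  ord_of_rel (well_order_relpre
    (val_inj : injective (val : {w : W | (w < y)%O} -> W)) (@ordP W)).

Lemma mono_ord_ge (W : ord) (f : W -> W) : {mono f : x y / (x <= y)%O} ->
  forall w, (w <= f w)%O.
Proof.
move=> fm; apply: ord_ind => w IH; rewrite leNgt; apply/negP => fw.
by have := IH _ fw; rewrite fm leNgt fw.
Qed.

Lemma segment_not_le (W : ord) (y : W) : ~ ord_le W (segment y).
Proof.
move=> [f fm _]; pose g (w : W) : W := val (f w : {w : W | (w < y)%O}).
have gm : {mono g : u v / (u <= v)%O} by move=> u v; exact: fm.
have := mono_ord_ge gm y; rewrite leNgt /g.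
by case: (f y : {w : W | (w < y)%O}) => z /= ->.
Qed.

Lemma card_segment (W : ord) (y : W) :
  ([set: segment y] #= [set w | (w < y)%O])%card.
Proof.
have <- : (val : {w : W | (w < y)%O} -> W) @` setT = [set w | (w < y)%O].
  by apply/seteqP; split=> [_ [[w wy] _ <-] //|w wy]; exists (exist _ w wy).
by rewrite card_eq_sym; apply: inj_card_eq; apply: in2W; exact: val_inj.
Qed.

Lemma transfinite_recursion (W : ord) (X : Type) (G : set X -> X) :
  exists f : W -> X, forall w, f w = G (f @` [set v | (v < w)%O]).
Proof.
have wf : well_founded (fun v w : W => (v < w)%O).
  by apply: ord_ind => w IH; constructor.
pose step (w : W) (rec : forall v, (v < w)%O -> X) : X :=
  G [set x | exists (v : W) (vw : (v < w)%O), rec v vw = x].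
exists (Fix wf (fun=> X) step) => w; rewrite Fix_eq => [|v r s rs].
  congr G; apply/seteqP; split=> x [v]; first by move=> [vw <-]; exists v.
  by move=> vw <-; exists v, vw.
by congr step; do 2!apply: functional_extensionality_dep => ?; exact: rs.
Qed.

Section Cardinals.
Local Open Scope card_scope.
Implicit Types T U V : Type.

Lemma set_inj_card_le T U (A : set T) (B : set U) (f : T -> U) :
  set_fun A B f -> {in A &, injective f} -> A #<= B.
Proof.
move=> fAB f_inj; have [g] : $|{injfun A >-> B}| by apply/injfunPex; exists f.
exact: inj_card_le.
Qed.

Lemma card_le_inj_in T U (u0 : U) (A : set T) :
  A #<= [set: U] -> exists f : T -> U, {in A &, injective f}.
Proof. by elim/Ppointed: U u0 => U u0 => [|/pcard_injP//]; have := no u0. Qed.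

Lemma card_leX T U V V' (A : set T) (B : set U) :
  A #<= [set: V] -> B #<= [set: V'] -> A `*` B #<= [set: V * V'].
Proof.
elim/Ppointed: V => V; first by rewrite card_le_emptyr => /eqP->; rewrite set0X.
elim/Ppointed: V' => V'.
  by rewrite card_le_emptyr => _ /eqP->; rewrite setX0.
move=> /pcard_injP[f f_inj] /pcard_injP[g g_inj]; apply/pcard_injP.
exists (fun p => (f p.1, g p.2)) => -[a b] [a' b'] /set_mem[/= Aa Bb].
move=> /set_mem[/= Aa' Bb'] [fE gE].
by congr pair; [apply: f_inj|apply: g_inj] => //; exact: mem_set.
Qed.

Lemma card_bigcup_le V I T (D : set I) (F : I -> set T) : D #<= [set: V] ->
  (forall i, D i -> F i #<= [set: V]) -> \bigcup_(i in D) F i #<= [set: V * V].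
Proof.
have [->|/eqP/set0P[x0 [i0 Di0 _]]] := pselect (\bigcup_(i in D) F i = set0).
  by [].
elim/Ppointed: V => V.
  by rewrite card_le_emptyr => /eqP D0; rewrite D0 in Di0.
move=> /pcard_injP[f f_inj] leF; apply/pcard_injP.
have /choice[g gP] i : exists g : T -> V, D i -> {in F i &, injective g}.
  have [/leF/pcard_injP[g g_inj]|nDi] := pselect (D i); first by exists g.
  by exists (fun=> point).
have /choice[k kP] x : exists i, (\bigcup_(i in D) F i) x -> D i /\ F i x.
  have [[i Di Fx]|nx] := pselect ((\bigcup_(i in D) F i) x); first by exists i.
  by exists i0.
exists (fun x => (f (k x), g (k x) x)) => x y.
move=> /set_mem/kP[Dx Fx] /set_mem/kP[Dy Fy] [fE gE].
have kE := f_inj _ _ (mem_set Dx) (mem_set Dy) fE; rewrite kE in Fx gE.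
exact: gP Dy _ _ (mem_set Fx) (mem_set Fy) gE.
Qed.

Lemma finite_card_le_infinite T U (A : set T) (B : set U) :
  finite_set A -> infinite_set B -> A #<= B.
Proof.
by move=> /finite_set_countable leA /infiniteP; apply: card_le_trans.
Qed.

Lemma card_setU_le T V (A B : set T) : infinite_set [set: V] ->
  A #<= [set: V] -> B #<= [set: V] -> A `|` B #<= [set: V * V].
Proof.
move=> /infiniteP nat_le leA leB; rewrite -bigcup2E.
by apply: card_bigcup_le => // -[|[|i]].
Qed.

Section GoedelOrder.
Variable W : ord.
Local Notation pair_max p := (Order.max p.1 p.2).

Let goedel_key (p : W * W) : ord_lexi W (ord_lexi W W) := (pair_max p, p).

Let goedel_key_inj : injective goedel_key.
Proof. by move=> p r []. Qed.

(* Pairs are compared first by their maximum, so that proper initial segments *)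
(* lie in squares of initial segments of W.                                   *)
Definition goedel_ord : ord :=
  ord_of_rel (well_order_relpre goedel_key_inj (@ordP _)).

Lemma goedel_ord_le_max (p r : goedel_ord) :
  (p <= r)%O -> (pair_max p <= pair_max r :> W)%O.
Proof. exact: (@ord_lexi_fst_le W _ (goedel_key p) (goedel_key r)). Qed.

Lemma card_le_initial_square : ~ ([set: W * W] #<= [set: W]) ->
  exists y : W,
    [set: W] #<= [set w : W | (w <= y)%O] `*` [set w : W | (w <= y)%O].
Proof.
move=> WW; have [[f fm _]|[x [g [gm gx]]]] := ord_comparable goedel_ord W.
  by case: WW; apply/card_le_setTP; exists f; exact: inc_inj fm.
exists (pair_max x); apply: (@set_inj_card_le _ _ _ _ (g : W -> W * W)).
  move=> w _ /=; apply/andP; rewrite -ge_max; apply: goedel_ord_le_max.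
  by apply/ltW/gx; exists w.
by apply: in2W; exact: inc_inj gm.
Qed.

End GoedelOrder.

Lemma initial_segmentE (W : ord) (y : W) :
  [set w | (w <= y)%O] = y |` [set w | (w < y)%O].
Proof.
apply/seteqP; split=> w /=; rewrite le_eqVlt.
  by move=> /orP[/eqP|]; [left|right].
by move=> [->|->]; rewrite ?eqxx ?orbT.
Qed.

Lemma card_initial_segment_le (W : ord) (y : W) :
  infinite_set [set: segment y] ->
  [set w | (w <= y)%O] #<= [set: segment y * segment y].
Proof.
move=> inf; rewrite initial_segmentE; apply: card_setU_le => //.
  exact: finite_card_le_infinite (finite_set1 y) inf.
by have /card_eqPle[] := card_segment y.
Qed.

Lemma card_ord_square_le (W : ord) : infinite_set [set: W] ->
  [set: W * W] #<= [set: W].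
Proof.
pose bad (e : ord) := infinite_set [set: e] /\ ~ ([set: e * e] #<= [set: e]).
move=> Winf; apply: contrapT => Wbad.
have [] := @least_ord_exists bad; first by exists W.
move=> {Wbad Winf}{}W [[Winf Wbad] Wmin].
have square (y : W) : infinite_set [set: segment y] ->
    [set: segment y * segment y] #<= [set: segment y].
  move=> inf; apply: contrapT => nsq; apply: (@segment_not_le W y).
  exact: Wmin.
have [y le_W] := card_le_initial_square Wbad.
have [fin|inf] := pselect (finite_set [set: segment y]).
  have fin_le : finite_set [set w | (w <= y)%O].
    rewrite initial_segmentE finite_setU; split; first exact: finite_set1.
    by move: fin; rewrite (eq_finite_set (card_segment y)).
  exact/Winf/(card_le_finite le_W)/finite_setX.
have {square}sq := square y inf.
have init_le : [set w | (w <= y)%O] #<= [set: segment y].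
  exact: card_le_trans (card_initial_segment_le inf) sq.
have W_le : [set: W] #<= [set: segment y].
  exact: card_le_trans le_W (card_le_trans (card_leX init_le init_le) sq).
apply: Wbad; rewrite -setXTT; apply: card_le_trans (card_leX W_le W_le) _.
apply: card_le_trans sq _.
have /card_eqPle[le_y _] := card_segment y.
exact: card_le_trans le_y (card_leT _).
Qed.

End Cardinals.

Lemma exists_map_eq (T : eqType) (U : Type) (h : U -> T) (s : seq T) :
  {in s, forall x, exists u, h u = x} -> exists us, map h us = s.
Proof.
elim: s => [|x s IH] hs; first by exists [::].
have [u <-] := hs x (mem_head _ _).
have [y ys|us <-] := IH; last by exists (u :: us).
by apply: hs; rewrite inE ys orbT.
Qed.

Section InfiniteCardinals.
Local Open Scope card_scope.
Variable V : Type.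
Hypothesis V_infinite : infinite_set [set: V].

Lemma card_square_le : [set: V * V] #<= [set: V].
Proof.
elim/Pchoice: V V_infinite => U U_infinite.
have [R Rwo] := well_ordering_principle U.
exact: (@card_ord_square_le (ord_of_rel Rwo)).
Qed.

Lemma card_bigcup_infinite I T (D : set I) (F : I -> set T) :
  D #<= [set: V] -> (forall i, D i -> F i #<= [set: V]) ->
  \bigcup_(i in D) F i #<= [set: V].
Proof.
by move=> leD leF; apply: card_le_trans card_square_le; apply: card_bigcup_le.
Qed.

Lemma card_sum_le T U : [set: T] #<= [set: V] -> [set: U] #<= [set: V] ->
  [set: T + U] #<= [set: V].
Proof.
move=> leT leU.
have -> : [set: T + U] = (inl @` setT) `|` (inr @` setT).
  by apply/seteqP; split=> // -[x|x] _; [left|right]; exists x.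
apply: card_le_trans (card_setU_le V_infinite _ _) card_square_le.
  exact: card_le_trans (card_image_le _ _) leT.
exact: card_le_trans (card_image_le _ _) leU.
Qed.

Lemma card_seq_le U : [set: U] #<= [set: V] -> [set: seq U] #<= [set: V].
Proof.
move=> leU; have -> : [set: seq U] = \bigcup_n [set s | size s = n].
  by apply/seteqP; split=> // s _; exists (size s).
apply: card_bigcup_infinite => [|n _]; first exact/infiniteP.
elim: n => [|n IH].
  have -> : [set s : seq U | size s = 0%N] = [set [::]].
    by apply/seteqP; split=> [[]|_ ->].
  exact: finite_card_le_infinite.
have -> : [set s : seq U | size s = n.+1] =
    (fun p => p.1 :: p.2) @` ([set: U] `*` [set s | size s = n]).
  apply/seteqP; split=> [[//|x s] [sn]|_ [[x s] [_ /= <-] <-] //].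
  by exists (x, s).
apply: card_le_trans (card_image_le _ _) _.
exact: card_le_trans (card_leX leU IH) card_square_le.
Qed.

Lemma card_tree_le U :
  [set: U] #<= [set: V] -> [set: GenTree.tree U] #<= [set: V].
Proof.
move=> leU; have /card_seq_le : [set: nat + U] #<= [set: V].
  by apply: card_sum_le leU; exact/infiniteP.
apply: card_le_trans; apply/card_le_setTP; exists (@GenTree.encode U).
exact: pcan_inj (@GenTree.codeK U).
Qed.

Section Closure.
Variables (T : eqType) (F : seq T -> seq T).
Implicit Types (X Y : set T) (t : seq T).

Inductive closure_of Y : set T :=
| closure_base x : Y x -> closure_of Y x
| closure_step t x : {in t, forall y, closure_of Y y} -> x \in F t ->
    closure_of Y x.

Definition closed_under X : Prop :=
  forall t, {in t, forall y, X y} -> {in F t, forall x, X x}.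

Lemma closure_closed Y : closed_under (closure_of Y).
Proof. by move=> t tY x; exact: closure_step. Qed.

Lemma closure_sub Y X : Y `<=` X -> closed_under X -> closure_of Y `<=` X.
Proof. by move=> YX XF x; elim=> [z /YX //|t z _ IH zt]; apply: XF zt. Qed.

Lemma closure_mono X Y : X `<=` Y -> closure_of X `<=` closure_of Y.
Proof.
move=> XY; apply: closure_sub (@closure_closed Y) => x /XY.
exact: closure_base.
Qed.

(* Every element of the closure is the value of a finite tree: leaves stand   *)
(* for elements of Y, and a node labelled i for the i-th entry of F at its    *)
(* subtrees.                                                                  *)
Lemma card_closure_le Y : Y #<= [set: V] -> closure_of Y #<= [set: V].
Proof.
rewrite -(card_le_eql (card_setT Y)) => /card_tree_le leY.
have [->|/set0P[x0 _]] := eqVneq (closure_of Y) set0; first exact: card_ge0.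
pose fix value (t : GenTree.tree Y) : T := match t with
  | GenTree.Leaf y => val y
  | GenTree.Node i ts => nth x0 (F (map value ts)) i
  end.
apply: card_le_trans (card_le_trans (card_image_le value _) leY).
apply: subset_card_le => x; elim=> [z Yz|t z _ IH zt].
  by exists (GenTree.Leaf (SigSub (mem_set Yz))).
have [y yt|ts tsE] := @exists_map_eq _ _ value t.
  by have [u _ <-] := IH y yt; exists u.
by exists (GenTree.Node (index z (F t)) ts); rewrite //= tsE nth_index.
Qed.

End Closure.

End InfiniteCardinals.

(** * Cardinals below aleph_n *)

Section Alephs.
Local Open Scope card_scope.

Lemma omega_infinite n (V : ord) : is_omega n V -> infinite_set [set: V].
Proof.
elim: n V => [|n IH] V /=; first by case.
move=> [V0 /IH V0_inf [V0V _]] V_fin; apply: V0V.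
exact: finite_card_le_infinite.
Qed.

Lemma ord_le_card (V W : ord) : ord_le V W -> [set: V] #<= [set: W].
Proof. by move=> [f fm _]; apply/card_le_setTP; exists f; exact: inc_inj. Qed.

Lemma omega_card_le n (V V' : ord) :
  is_omega n V -> is_omega n V' -> [set: V] #<= [set: V'].
Proof.
elim: n V V' => [|n IH] V V' /=.
  by move=> [_ minV] [V'inf _]; apply: ord_le_card; apply: minV.
move=> [V0 V0n [_ minV]] [V0' V0'n [V'V0' _]]; apply: ord_le_card; apply: minV.
by move=> V'V0; apply: V'V0'; apply: card_le_trans V'V0 (IH _ _ V0n V0'n).
Qed.

Definition card_lt_aleph n T (A : set T) : Prop :=
  if n is m.+1 then exists2 V, is_omega m V & A #<= [set: V] else finite_set A.

Lemma card_lt_aleph_le n T U (A : set T) (B : set U) :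
  A #<= B -> card_lt_aleph n B -> card_lt_aleph n A.
Proof.
move=> AB; case: n => [|n] /=; first exact: card_le_finite.
by move=> [V Vn BV]; exists V => //; exact: card_le_trans BV.
Qed.

Lemma omega_card_lt_aleph n (W : ord) :
  is_omega n W -> ~ card_lt_aleph n [set: W].
Proof.
case: n => [|n] /=; first by case.
move=> [V0 V0n [WV0 _]] [V Vn WV]; apply: WV0.
exact: card_le_trans WV (omega_card_le Vn V0n).
Qed.

Lemma finite_card_lt_aleph n T (A : set T) : finite_set A -> card_lt_aleph n A.
Proof.
case: n => [//|n] A_fin; have [V Vn] := is_omega_exists n; exists V => //.
exact: finite_card_le_infinite (omega_infinite Vn).
Qed.

Lemma card_lt_aleph_segment n (W : ord) (y : W) :
  is_omega n W -> card_lt_aleph n [set w | (w < y)%O].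
Proof.
have /card_eqPle[seg_le le_seg] := card_segment y.
case: n => [|n] /= Wn.
  apply: contrapT => y_inf; apply: (@segment_not_le W y); apply: Wn.2.
  by rewrite /= (eq_finite_set (card_segment y)).
have [V Vn [_ minW]] := Wn; exists V => //; apply: card_le_trans le_seg _.
by apply: contrapT => /minW/segment_not_le.
Qed.

Lemma card_lt_aleph_bigcup n I T (D : set I) (F : I -> set T) :
  card_lt_aleph n D -> (forall i, D i -> card_lt_aleph n (F i)) ->
  card_lt_aleph n (\bigcup_(i in D) F i).
Proof.
case: n => [|n] /=; first exact: bigcup_finite.
move=> [V Vn DV] FV; exists V => //.
apply: (card_bigcup_infinite (omega_infinite Vn)) => // i /FV[V' V'n FV'].
exact: card_le_trans FV' (omega_card_le V'n Vn).
Qed.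

Lemma card_lt_aleph_setU n T (A B : set T) :
  card_lt_aleph n A -> card_lt_aleph n B -> card_lt_aleph n (A `|` B).
Proof.
move=> ltA ltB; rewrite -bigcup2inE.
apply: card_lt_aleph_bigcup => [|[|[|i]]] //.
exact: finite_card_lt_aleph.
Qed.

End Alephs.

Section Directed.
Context {d} {T : orderType d}.
Implicit Types (D Y : set T) (n : nat).

Definition strict_upper_bounds D Y : set T :=
  [set g | D g /\ forall y, Y y -> (y < g)%O].

Definition aleph_directed n D : Prop := forall Y, Y `<=` D ->
  card_lt_aleph n Y -> strict_upper_bounds D Y !=set0.

Lemma aleph_directed_neq0 n D : aleph_directed n D -> D !=set0.
Proof.
move=> D_dir; have [//||g [Dg _]] := D_dir set0; last by exists g.
exact: finite_card_lt_aleph.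
Qed.

Lemma aleph_directed_gt n D b :
  aleph_directed n D -> D b -> exists2 c, D c & (b < c)%O.
Proof.
move=> D_dir Db; have [_ ->//||c [Dc bc]] := D_dir [set b].
  exact/finite_card_lt_aleph/finite_set1.
by exists c => //; apply: bc.
Qed.

End Directed.

Lemma omega_directed n (W : ord) : is_omega n W -> aleph_directed n [set: W].
Proof.
move=> Wn Y _ Y_lt; apply: contrapT => unbounded.
apply: (omega_card_lt_aleph Wn).
have -> : [set: W] = Y `|` \bigcup_(y in Y) [set w | (w < y)%O].
  apply/seteqP; split=> // w _; apply: contrapT => nw; apply: unbounded.
  exists w; split=> // y Yy; rewrite ltNge le_eqVlt.
  apply/negP => /orP[/eqP wy|wy].
    by apply: nw; left; rewrite wy.
  by apply: nw; right; exists y.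
apply: card_lt_aleph_setU => //; apply: card_lt_aleph_bigcup => // y _.
exact: card_lt_aleph_segment.
Qed.

Section DirectedHull.
Context {d} {T : orderType d}.
Variables (n : nat) (D : set T) (F : seq T -> seq T) (W : ord).
Hypothesis D_directed : aleph_directed n.+1 D.
Hypothesis D_closed : closed_under F D.
Hypothesis W_omega : is_omega n W.

Let stage (f : W -> T) w := closure_of F (f @` [set v | (v < w)%O]).

Lemma card_closure_image_lt (f : W -> T) (A : set W) :
  card_lt_aleph n.+1 (closure_of F (f @` A)).
Proof.
exists W => //; apply: card_closure_le; first exact: omega_infinite W_omega.
exact: card_le_trans (card_image_le _ _) (card_leT _).
Qed.

Lemma stages_strict_upper_bounds :
  exists f : W -> T, forall w, strict_upper_bounds D (stage f w) (f w).
Proof.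
have [d0 _] := aleph_directed_neq0 D_directed.
pose bound Y := xget d0 (strict_upper_bounds D Y).
have [f fE] := transfinite_recursion W (fun Y => bound (closure_of F Y)).
exists f; elim/ord_ind => w IH; rewrite fE; apply: xgetPex.
apply: D_directed; last exact: card_closure_image_lt.
by apply: closure_sub D_closed => _ [v /IH[Dv _] <-].
Qed.

Section Stages.
Variable f : W -> T.
Hypothesis f_bound : forall w, strict_upper_bounds D (stage f w) (f w).

Let hull := closure_of F (range f).

Let stage_mono v w : (v <= w)%O -> stage f v `<=` stage f w.
Proof.
move=> vw; apply: closure_mono => _ [u uv <-].
by exists u => //; exact: lt_le_trans uv vw.
Qed.

Let W_directed := omega_directed W_omega.

Let stage_bounded (Y : set T) : Y `<=` \bigcup_w stage f w ->
  card_lt_aleph n Y -> exists w, Y `<=` stage f w.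
Proof.
move=> Y_stage Y_lt; have [w0 _] := aleph_directed_neq0 W_directed.
pose rank y := xget w0 (stage f ^~ y).
have rankP y : Y y -> stage f (rank y) y.
  by move=> /Y_stage[w _ wy]; exact: (@xgetPex _ w0 (stage f ^~ y) (ex_intro _ w wy)).
have [//||w [_ wP]] := W_directed (Y := rank @` Y).
  exact: card_lt_aleph_le (card_image_le _ _) Y_lt.
exists w => y Yy; apply: stage_mono (rankP y Yy).
by apply/ltW/wP; exists y.
Qed.

Lemma hull_stage : hull `<=` \bigcup_w stage f w.
Proof.
apply: closure_sub => [_ [w _ <-]|t t_stage x xt].
  have [v _ wv] := aleph_directed_gt W_directed (I : setT w).
  by exists v => //; apply: closure_base; exists w.
have [|w tw] := stage_bounded (Y := [set` t]) t_stage.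
  exact/finite_card_lt_aleph/finite_seq.
by exists w => //; exact: closure_step tw xt.
Qed.

Lemma hull_directed : aleph_directed n hull.
Proof.
move=> Y Y_hull /(stage_bounded (subset_trans Y_hull hull_stage))[w Yw].
exists (f w); split; first by apply: closure_base; exists w.
by move=> y /Yw; apply: (f_bound w).2.
Qed.

End Stages.

Lemma directed_closed_subset : exists D', [/\ D' `<=` D, aleph_directed n D',
  closed_under F D' & strict_upper_bounds D D' !=set0].
Proof.
have [f f_bound] := stages_strict_upper_bounds; exists (closure_of F (range f)).
have hull_D : closure_of F (range f) `<=` D.
  by apply: closure_sub D_closed => _ [w _ <-]; exact: (f_bound w).1.
split=> //; first exact: hull_directed f_bound.
  exact: closure_closed.
exact/D_directed/card_closure_image_lt.
Qed.

End DirectedHull.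

(** * Bases and splittings of boundaries by cardinality *)

Lemma card_lt_aleph_boundary_basis n d (T : orderType d) (A : set T) :
  card_lt_aleph n A -> exists S, boundary_basis n.+1 A S.
Proof.
elim: n A => [|n IH] A /=; first exact: finite_boundary_basis.
move=> [V Vn leA]; have [v0 _] := infinite_setN0 (omega_infinite Vn).
have [f f_inj] := card_le_inj_in v0 leA.
apply: (boundary_basisS f_inj) => b Ab; apply: IH.
apply: card_lt_aleph_le (card_lt_aleph_segment (f b) Vn).
apply: (set_inj_card_le (f := f)) => [c []|] //.
by move=> c c' /set_mem[Ac _] /set_mem[Ac' _]; apply: f_inj; exact: mem_set.
Qed.

Lemma no_boundary_splitting n d (T : orderType d) (D : set T) f :
  aleph_directed n D -> ~ boundary_splitting n.+1 D f.
Proof.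
elim: n D f => [|n IH] D f D_dir f_split.
  apply: no_boundary_splitting1 f_split; first exact: aleph_directed_neq0 D_dir.
  by move=> b; exact: aleph_directed_gt D_dir.
have f_D t : simplex n.+2 D t ->
    {in dom (f << t >>), forall s, simplex n.+2 D s}.
  move=> tD; apply/supportedP; apply: boundary_splitting_simplex f_split _.
  exact: supportedU.
pose F t := if `[< simplex n.+2 D t >] then flatten (dom (f << t >>)) else [::].
have D_closed : closed_under F D.
  move=> t _ x; rewrite /F; case: asboolP => // /f_D tD /flattenP[s /tD].
  by move=> [_ _]; apply.
have [W W_omega] := is_omega_exists n.
have [D' [D'D D'_dir D'_closed [g [Dg D'g]]]] :=
  directed_closed_subset D_dir D_closed W_omega.
apply: IH D'_dir (descent_splitting f_split D'D Dg D'g _) => x xD'.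
apply: linear_supported xD' _ => t tD'; have [_ _ t_D'] := tD'.
have tD : simplex n.+2 D t by exact: simplex_sub tD'.
apply/supportedP => s s_ft; have [ss sn _] := f_D t tD s s_ft.
split=> // a as_; apply: (D'_closed t t_D'); rewrite /F; case: asboolP => // _.
by apply/flattenP; exists s.
Qed.

(** * The inverse systems d_n P_n *)

Section ChainsAsLists.
Variable e : ord.
Implicit Types (s : seq e) (k : nat).

Fact bdry_is_scalable k : scalable (@bdry e k).
Proof. by move=> c x; rewrite [LHS]linearZ. Qed.
HB.instance Definition _ k :=
  GRing.isScalable.Build int (chains e k.+1) (chains e k) _ (@bdry e k)
    (@bdry_is_scalable k).

Lemma bdryU k (t : incr e k.+1) :
  bdry << t >> = \sum_(i < k.+1) (-1) ^+ i *: << omit t i >>.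
Proof. exact: fglift1. Qed.

Definition to_list k : chains e k -> {freeg (seq e)} :=
  freeg_map (fun t : incr e k => val t : seq e).
HB.instance Definition _ k := GRing.Linear.on (@to_list k).

Definition incr_of_seq k s : option (incr e k) :=
  obind insub (insub s : option (k.-tuple e)).

Definition of_list k : {freeg (seq e)} -> chains e k :=
  fglift (fun s => if incr_of_seq k s is Some t then << t >> else 0).
HB.instance Definition _ k := GRing.Linear.on (@of_list k).

Lemma to_listU k (t : incr e k) : to_list << t >> = << (val t : seq e) >>.
Proof. exact: freeg_mapU. Qed.

Lemma incr_simplex k (t : incr e k) : simplex k setT (val t).
Proof. by split=> //; [exact: (valP t)|exact: size_tuple]. Qed.

Lemma simplex_incr k s :
  simplex k setT s -> exists t : incr e k, val t = s :> seq e.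
Proof. by move=> [ss /eqP sk _]; exists (@Incr e k (Tuple sk) ss). Qed.

Lemma of_listU k (t : incr e k) : of_list k << (val t : seq e) >> = << t >>.
Proof. by rewrite [LHS]fglift1 /incr_of_seq /= !valK /= valK. Qed.

Lemma to_listK k : cancel (@to_list k) (@of_list k).
Proof.
apply: (eq_linear (f := of_list k \o @to_list k) (g := idfun)) => t /=.
by rewrite to_listU of_listU.
Qed.

Lemma of_listK k x :
  x \in supported (simplex k setT) -> to_list (of_list k x) = x.
Proof.
move=> xk; apply: (eq_linear_supported xk (f := @to_list k \o of_list k)
  (g := idfun)) => _ /simplex_incr[t <-] /=.
by rewrite of_listU to_listU.
Qed.

Lemma of_list_supported k x (P : set (seq e)) : P `<=` simplex k setT ->
  x \in supported P ->
  of_list k x \in supported (fun t : incr e k => P (val t)).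
Proof.
move=> Pk xP; apply: linear_supported xP _ => s Ps.
have [t ts] := simplex_incr (Pk _ Ps).
by rewrite -ts in Ps *; rewrite /= of_listU supportedU.
Qed.

Lemma to_list_supported k x (P : set (seq e)) :
  x \in supported (fun t : incr e k => P (val t)) -> to_list x \in supported P.
Proof.
move=> xP; apply: linear_supported xP _ => t Pt.
by rewrite /= to_listU supportedU.
Qed.

Lemma contract_seq1E s : contract_seq (fun=> 1) s =
  \sum_(i < size s) (-1) ^+ i *: << take i s ++ drop i.+1 s >>.
Proof.
elim: s => [|a s IH] /=; first by rewrite big_ord0.
rewrite big_ord_recl /= drop0 expr0 IH linear_sum -sumrN; congr (_ + _).
apply: eq_bigr => i _; rewrite linearZ /= prependU /bump /= add1n exprS mulN1r.
by rewrite scaleNr.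
Qed.

Lemma val_omit k (t : incr e k.+1) (i : 'I_k.+1) :
  val (omit t i) = take i (val t) ++ drop i.+1 (val t) :> seq e.
Proof.
have x0 : e := tnth t i.
have size_t : size (val t : seq e) = k.+1 by exact: size_tuple.
apply: (@eq_from_nth _ x0).
  rewrite size_tuple size_cat size_takel ?size_drop size_t; last exact: ltnW.
  by rewrite subSS subnKC // -ltnS.
move=> j; rewrite size_tuple => jk; rewrite -[j]/(val (Ordinal jk)) -tnth_nth.
rewrite tnth_mktuple (tnth_nth x0) /= nth_cat size_takel ?size_t; last first.
  exact: ltnW.
rewrite /bump; case: leqP => ij; last by rewrite add0n nth_take.
by rewrite nth_drop add1n addSn subnKC.
Qed.

Lemma to_list_bdry k (x : chains e k.+1) :
  to_list (bdry x) = boundary (to_list x).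
Proof.
apply: (eq_linear (f := @to_list k \o @bdry e k)
  (g := boundary \o @to_list k.+1)) => t /=.
rewrite bdryU to_listU linear_sum [RHS]contractU contract_seq1E.
rewrite (size_tuple (val t)); apply: eq_bigr => i _.
by rewrite linearZ /= to_listU -val_omit.
Qed.

Lemma chains_inE k (A : {pred e}) :
  chains_in (k := k) A =i
    supported (fun t : incr e k => all (mem A) (val t : seq e)).
Proof. by move=> x; apply/allP/supportedP. Qed.

Lemma incr_head_le k (t : incr e k.+1) : all (>= tnth t ord0)%O (val t : seq e).
Proof.
have [+ _ _] := incr_simplex t; rewrite (tnth_nth (tnth t ord0)) /=.
case: (val (val t)) => [//|a s] /= sa.
by apply: (@simplex_head_le _ _ (size s).+1 setT).
Qed.

End ChainsAsLists.

Lemma reduced_perm_eq (K : choiceType) (s s' : seq (int * K)) :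
  reduced s -> reduced s' -> [freeg s] = [freeg s'] -> perm_eq s s'.
Proof.
move=> rs rs' eq_ss'; apply: contrapT => /negP n_ss'.
have := freegequivP rs rs'; rewrite /fgequiv (negPf n_ss') => /elimF.
by apply=> // x; rewrite -!coeff_Freeg eq_ss'.
Qed.

Section TailBasis.
Variables (e : ord) (n : nat).
Local Notation K := {b : e & dP_term n b}.
Implicit Types (a : e) (B : forall b : e, set (dP_term n b)).
Implicit Types (p : K) (z : {freeg K}).

Definition evaluate : {freeg K} -> chains e n :=
  fglift (fun p => dP_val (tagged p)).
HB.instance Definition _ := GRing.Linear.on evaluate.

Lemma evaluateU p : evaluate << p >> = dP_val (tagged p).
Proof. exact: fglift1. Qed.

Definition generators B : set K := [set p | B (tag p) (tagged p)].

Definition generators_above B a : set K :=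
  [set p | generators B p /\ (a <= tag p)%O].

(* All bonding maps being inclusions, freeness of the system can be tested in *)
(* the single group chains e n.                                               *)
Definition tail_basis B : Prop :=
  (forall a (y : dP_term n a), exists2 z,
     z \in supported (generators_above B a) & evaluate z = dP_val y) /\
  (forall z, z \in supported (generators B) -> evaluate z = 0 -> z = 0).

Section Level.
Variable a : e.
Local Notation Ka := {b : {b : e | (a <= b)%O} & dP_term n (val b)}.
Implicit Types (s : seq (int * Ka)) (y : dP_term n a) (q : Ka).

Definition forget_level q : K := Tagged (dP_term n) (tagged q).

Lemma forget_level_inj : injective forget_level.
Proof.
move=> [[b hb] y] [[c hc] y']; rewrite /forget_level /Tagged /= => eq_by.
have b_c : b = c := congr1 (@projT1 _ _) eq_by; subst c.
by rewrite (bool_irrelevance hb hc) (eq_from_Tagged eq_by).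
Qed.

Lemma forget_level_onto p : (a <= tag p)%O -> exists q, forget_level q = p.
Proof.
case: p => b y ab; pose term_at (c : {c : e | (a <= c)%O}) := dP_term n (val c).
by exists (@existT _ term_at (exist _ b ab) y).
Qed.

Definition collect s : {freeg K} :=
  [freeg [seq (c.1, forget_level c.2) | c <- s]].

Lemma reduced_forget_level s :
  reduced [seq (c.1, forget_level c.2) | c <- s] = reduced s.
Proof.
rewrite /reduced -map_comp all_map.
by rewrite (map_comp forget_level snd) (map_inj_uniq forget_level_inj).
Qed.

Lemma collect_supported s (P : set K) :
  (forall c, c \in s -> P (forget_level c.2)) -> collect s \in supported P.
Proof.
move=> sP; have -> : collect s = \sum_(c <- s) c.1 *: << forget_level c.2 >>.
  rewrite /collect; elim: (s) => [|c t IH]; first by rewrite big_nil freeg_nil.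
  by rewrite /= -cat1s freeg_cat IH big_cons freegUZ.
by rewrite big_seq rpred_sum // => c /sP Pc; rewrite rpredZ ?supportedU.
Qed.

Lemma dom_collect s c :
  reduced s -> c \in s -> forget_level c.2 \in dom (collect s).
Proof.
rewrite -reduced_forget_level => rs cs; rewrite mem_dom coeff_Freeg.
rewrite (@precoeff_mem_uniqE _ _ _ (c.1, forget_level c.2)).
- by have /andP[_ /allP/(_ (c.1, forget_level c.2))] := rs; apply; apply: map_f.
- exact: reduced_uniq.
- exact: (map_f (fun c => (c.1, forget_level c.2))).
Qed.

Lemma evaluate_collect s : evaluate (collect s) =
  dP_val (\sum_(c <- s) bond (dP e n) (valP (tag c.2)) (tagged c.2) *~ c.1).
Proof.
rewrite [LHS]fglift_Freeg /prelift big_map.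
rewrite -[RHS]/(\val (_ : dP_term n a)) raddf_sum.
by apply: eq_bigr => c _; rewrite raddfMz /= -[c.1 in LHS]intz scaler_int.
Qed.

Lemma decompositionP B y s : decomposition (X := dP e n) B y s <->
  [/\ reduced s, collect s \in supported (generators B)
    & evaluate (collect s) = dP_val y].
Proof.
split=> [[rs sB ->]|[rs /supportedP sB yE]].
  by split=> //; [apply: collect_supported => c /sB|exact: evaluate_collect].
split=> // [c cs|]; first exact: sB (dom_collect rs cs).
by apply: val_inj; rewrite -[LHS]yE; exact: evaluate_collect.
Qed.

Lemma collect_perm_eq s s' :
  reduced s -> reduced s' -> collect s = collect s' -> perm_eq s s'.
Proof.
rewrite -2!reduced_forget_level => rs rs' /(reduced_perm_eq rs rs').
apply: perm_map_inj => -[i q] [i' q'] eq_iq.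
have /= -> := congr1 fst eq_iq.
by have /= /forget_level_inj-> := congr1 snd eq_iq.
Qed.

Lemma collect_onto B z : z \in supported (generators_above B a) ->
  exists2 s, reduced s & collect s = z.
Proof.
move=> /supportedP zB.
have [p /zB[_]|qs qsE] := @exists_map_eq _ _ forget_level (dom z).
  exact: forget_level_onto.
pose s := [seq (coeff (forget_level q) z, q) | q <- qs].
have sE : [seq (c.1, forget_level c.2) | c <- s] =
    [seq (coeff p z, p) | p <- dom z].
  by rewrite -qsE -!map_comp.
exists s; last by rewrite /collect sE Freeg_dom.
rewrite -reduced_forget_level sE /reduced -map_comp map_id uniq_dom all_map.
by apply/allP => p; rewrite /= mem_dom.
Qed.

End Level.

Lemma tail_basis_free B : tail_basis B -> free_invsys (dP e n).
Proof.
move=> [spanB freeB]; exists B => a y; have [z zB zy] := spanB a y.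
have [s rs sz] := collect_onto zB.
have zB' : z \in supported (generators B) by apply: supported_sub zB => p [].
exists s; first by apply/decompositionP; rewrite sz.
move=> s' /decompositionP[rs' s'B s'y]; apply: collect_perm_eq => //.
apply/eqP; rewrite sz -subr_eq0 (freeB (z - collect s')) ?rpredB //.
by rewrite linearB /= zy s'y subrr.
Qed.

Lemma free_tail_basis : free_invsys (dP e n) -> exists B, tail_basis B.
Proof.
move=> [B decB]; exists B; split=> [a y|z zB z0].
  have [s /decompositionP[_ sB sy] _] := decB a y.
  exists (collect s) => //; apply: supportedI => //.
  by apply: collect_supported => c _; exact: (valP (tag c.2)).
apply: contrapT => /[dup] + /freeg_neq0_dom[p _]; apply.
have [a [_ mina]] := @ord_min e (fun=> True) (ex_intro _ (tag p) I).
have [|s rs sz] := @collect_onto a B z.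
  by apply: supportedI => //; apply/supportedP => q _; exact: mina.
have [s0 _ uniq_s0] := decB a 0.
have s_dec : decomposition (X := dP e n) B (0 : dP_term n a) s.
  by apply/decompositionP; rewrite sz.
have nil_dec : decomposition (X := dP e n) B (0 : dP_term n a) [::].
  by split=> //; rewrite big_nil.
have : perm_eq s [::] by rewrite -(permPl (uniq_s0 _ s_dec)) uniq_s0.
by move=> /perm_nilP s_nil; rewrite -sz s_nil /collect freeg_nil.
Qed.

End TailBasis.

Section BasesAndSplittings.
Variables (e : ord) (n : nat).
Local Notation K := {b : e & dP_term n b}.
Implicit Types (a : e) (t : incr e n.+1) (p : K) (S : set (seq e)).

Fact boundary_term_subproof t : bdry << t >> \in dP_pred (tnth t ord0).
Proof.
apply/asboolP; exists << t >> => //; rewrite chains_inE supportedU //.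
exact: incr_head_le.
Qed.

Definition boundary_term t : K :=
  Tagged (dP_term n) (DPTerm (boundary_term_subproof t)).

Lemma evaluate_boundary_term (x : chains e n.+1) :
  evaluate (freeg_map boundary_term x) = bdry x.
Proof.
apply: (eq_linear (f := @evaluate e n \o freeg_map boundary_term)
  (g := @bdry e n)) => t /=.
by rewrite freeg_mapU evaluateU.
Qed.

Lemma tail_incr_simplex a t :
  all (>= a)%O (val t : seq e) -> simplex n.+1 (tail setT a) (val t).
Proof. by move=> ta; apply/simplex_tail; split=> //; exact: incr_simplex. Qed.

Lemma chains_in_tail a (x : chains e n.+1) :
  x \in chains_in [pred b : e | (a <= b)%O] ->
  to_list x \in supported (simplex n.+1 (tail setT a)).
Proof.
rewrite chains_inE => xa; apply: to_list_supported.
apply: supported_sub xa => t.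
exact: tail_incr_simplex.
Qed.

Definition boundary_generators (S : set (seq e)) (b : e) : set (dP_term n b) :=
  [set y | exists2 t : incr e n.+1,
     S (val t) & boundary_term t = Tagged (dP_term n) y].

Lemma boundary_generatorsE S p : generators (boundary_generators S) p <->
  exists2 t : incr e n.+1, S (val t) & boundary_term t = p.
Proof. by case: p. Qed.

Section TailBasisOfBoundaryBasis.
Variable S : set (seq e).
Hypothesis S_basis : boundary_basis n.+1 setT S.

Let S_simplex : S `<=` simplex n.+1 setT. Proof. by have [] := S_basis. Qed.

Lemma boundary_generators_span a (y : dP_term n a) :
  exists2 z, z \in supported (generators_above (boundary_generators S) a)
    & evaluate z = dP_val y.
Proof.
have /asboolP[x xa ->] := valP y.
have /asboolP[c cS cx] := boundary_basis_span S_basis (chains_in_tail xa).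
have aboveS : above S a `<=` simplex n.+1 setT by move=> s [/S_simplex].
exists (freeg_map boundary_term (of_list n.+1 c)).
  apply: linear_supported (of_list_supported aboveS cS) _ => t [St /allP ta].
  rewrite /= freeg_mapU supportedU //; split; last exact/ta/mem_tnth.
  by apply/boundary_generatorsE; exists t.
rewrite evaluate_boundary_term; apply: (can_inj (@to_listK e n)).
by rewrite !to_list_bdry of_listK // (supported_sub aboveS cS).
Qed.

Lemma boundary_generators_free z :
  z \in supported (generators (boundary_generators S)) ->
  evaluate z = 0 -> z = 0.
Proof.
move=> zS z0; have /choice[lift liftP] p : exists x : chains e n.+1,
    generators (boundary_generators S) p ->
    x \in supported (fun t => S (val t)) /\ freeg_map boundary_term x = << p >>.
  have [/boundary_generatorsE[t St <-]|np] :=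
    pselect (generators (boundary_generators S) p); last by exists 0.
  by exists << t >> => _; rewrite freeg_mapU supportedU.
have zE : freeg_map boundary_term (fglift lift z) = z.
  apply: (eq_linear_supported zS (f := freeg_map boundary_term \o fglift lift)
    (g := idfun)) => p /liftP[_] /=.
  by rewrite fglift1.
have liftS : fglift lift z \in supported (fun t : incr e n.+1 => S (val t)).
  by apply: linear_supported zS _ => p /liftP[+ _]; rewrite /= fglift1.
rewrite -zE -[fglift lift z]to_listK.
have [_ S_free _] := S_basis; rewrite (S_free (to_list _)) ?linear0 //.
  exact: to_list_supported.
by rewrite -to_list_bdry -evaluate_boundary_term zE z0 linear0.
Qed.

Lemma boundary_basis_tail_basis : tail_basis (boundary_generators S).
Proof.
by split; [exact: boundary_generators_span|exact: boundary_generators_free].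
Qed.

End TailBasisOfBoundaryBasis.

Section Splitting.
Variable B : forall b : e, set (dP_term n b).
Hypothesis B_basis : tail_basis B.

Lemma dP_term_preimage p : exists x : chains e n.+1,
  x \in chains_in [pred b : e | (tag p <= b)%O] /\ bdry x = dP_val (tagged p).
Proof. by have /asboolP[x xp px] := valP (tagged p); exists x. Qed.

Lemma bdry_decomposition t : exists z : {freeg K},
  z \in supported (generators_above B (tnth t ord0)) /\
  evaluate z = bdry << t >>.
Proof.
by have [z zB zt] := B_basis.1 _ (tagged (boundary_term t)); exists z.
Qed.

Lemma tail_basis_splitting :
  exists f : {linear {freeg (seq e)} -> {freeg (seq e)}},
    boundary_splitting n.+1 setT f.
Proof.
have [r rP] := choice dP_term_preimage.
have [z zP] := choice bdry_decomposition.
exists (@to_list e n.+1 \o fglift r \o fglift z \o @of_list e n.+1).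
have bdry_r y : bdry (fglift r y) = evaluate y.
  apply: (eq_linear (f := @bdry e n \o fglift r) (g := @evaluate e n)) => p /=.
  by rewrite fglift1 (rP p).2 evaluateU.
have evaluate_z x : evaluate (fglift z x) = bdry x.
  apply: (eq_linear (f := @evaluate e n \o fglift z) (g := @bdry e n)) => t /=.
  by rewrite fglift1 (zP t).2.
split=> [a x xa|x xT|x xT x0] /=.
- have {}xa := of_list_supported (simplex_sub (@subsetT _ _)) xa.
  have zxa : fglift z (of_list n.+1 x) \in supported (fun p => (a <= tag p)%O).
    apply: linear_supported xa _ => t [_ _ /(_ _ (mem_tnth ord0 t))[_ at0]].
    rewrite /= fglift1; apply: supported_sub (zP t).1 => p [_].
    exact: le_trans.
  apply: chains_in_tail; rewrite chains_inE.
  apply: linear_supported zxa _ => p ap; rewrite /= fglift1.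
  have := (rP p).1; rewrite chains_inE; apply: supported_sub => t.
  by apply: sub_all => b; exact: le_trans.
- by rewrite -to_list_bdry bdry_r evaluate_z to_list_bdry of_listK.
rewrite (B_basis.2 (fglift z (of_list n.+1 x))) ?linear0 //.
  apply: linear_supported (supported_dom _) _ => t _; rewrite /= fglift1.
  by apply: supported_sub (zP t).1 => p [].
rewrite evaluate_z; apply: (can_inj (@to_listK e n)).
by rewrite to_list_bdry of_listK // x0 linear0.
Qed.

End Splitting.

End BasesAndSplittings.

Theorem theorem3p10 (n : nat) (n_ge1 : (1 <= n)%N) (e : ord) :
  is_omega n e -> is_least_ord (fun e' : ord => ~ free_invsys (dP e' n)) e.
Proof.
move=> e_omega; split=> [|e' e'_nfree].
  move=> /free_tail_basis[B /tail_basis_splitting[f]].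
  exact/no_boundary_splitting/omega_directed.
have [//|[x [g [gm gx]]]] := ord_comparable e e'; case: e'_nfree.
have [S /boundary_basis_tail_basis/tail_basis_free//] :
    exists S, boundary_basis n.+1 [set: e'] S.
apply: card_lt_aleph_boundary_basis.
apply: card_lt_aleph_le (card_lt_aleph_segment x e_omega).
apply: (set_inj_card_le (f := g)) => [w _|]; first by apply/gx; exists w.
by apply: in2W; exact: inc_inj gm.
Qed.
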